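(* Let $n\ge2$, let $\mathcal{S}$ be a compact topological hypersurface which is the boundary of a Jordan domain in $\mathbb{R}^n$, and let $g\in C^{0,\nu}(\mathcal{S})$ be $\mathcal{C}\ell(n)$-valued, $0<\nu\le1$, with $\nu>1-\dfrac{\mathfrak{m}(\mathcal{S})}{n}$, and let $\mu$ satisfy $$\dim_H\mathcal{S}-(n-1)<\mu<1-\frac{n(1-\nu)}{\mathfrak{m}(\mathcal{S})}.$$ Then the solution to the scalar additive Jump problem $$\Phi^+(\underline{x})-\Phi^-(\underline{x})=g(\underline{x}),\qquad \underline{x}\in\mathcal{S},$$ is unique in the classes $C^{0,\mu}(\overline{\Omega^+})$ and $C^{0,\mu}(\overline{\Omega^-})$; that is, any two solutions whose continuous extensions to $\overline{\Omega^+}$ and $\overline{\Omega^-}$ belong to $C^{0,\mu}(\overline{\Omega^+})$ and $C^{0,\mu}(\overline{\Omega^-})$, respectively, coincide.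
   Context: $\mathcal{C}\ell(n)$ is the real unital associative Clifford algebra generated by the standard orthonormal basis $e_1,\dots,e_n$ of $\mathbb{R}^n$ with $e_ie_j+e_je_i=-2\delta_{ij}$, with the Euclidean norm in the basis $e_A=e_{\beta_1}\cdots e_{\beta_k}$, $A=\{\beta_1<\dots<\beta_k\}\subseteq\{1,\dots,n\}$. The Dirac operator is $\partial_n=\sum_{j=1}^n e_j\,\partial/\partial x^j$; a $C^1$ function $u$ on an open subset of $\mathbb{R}^n$ with values in $\mathcal{C}\ell(n)$ is (left) monogenic if $\partial_nu=0$. $C^{0,\nu}(\mathbf{E})$ ($0<\nu\le 1$) is the set of functions $f$ on $\mathbf{E}$ with $|f(x)-f(y)|\le M|x-y|^\nu$ for all $x,y\in\mathbf{E}$, some $M$. $\dim_H$ is Hausdorff dimension. $\Omega^+$ denotes the (bounded) Jordan domain bounded by $\mathcal{S}$ and $\Omega^-=\mathbb{R}^n\setminus(\Omega^+\cup\mathcal{S})$ the unbounded complement. $\mathcal{S}$ may be fractal. Scalar additive Jump problem: given $g$, find a function $\Phi$ monogenic on $\mathbb{R}^n\setminus\mathcal{S}$, continuously extendable from $\Omega^\pm$ to $\mathcal{S}$, whose boundary values $\Phi^\pm$ on $\mathcal{S}$ (from $\Omega^\pm$) satisfy $\Phi^+-\Phi^-=g$ on $\mathcal{S}$, and with $\Phi(\infty):=\lim_{|\underline x|\to\infty}\Phi(\underline x)=c$ for a given constant $c\in\mathcal{C}\ell(n)$. Marcinkiewicz exponent: for a bounded set $D\subset\mathbb{R}^n$ not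 meeting $\mathcal{S}$ put $I_p(D)=\int_D \mathrm{dist}(x,\mathcal{S})^{-p}\,dV(x)$. Let $\Omega^*=\Omega^-\cap\{|x|<r\}$ with $r$ such that $\mathcal{S}$ lies inside the ball of radius $r$ (the choice is immaterial). Then $\mathfrak{m}^+(\mathcal{S})=\sup\{p: I_p(\Omega^+)<\infty\}$, $\mathfrak{m}^-(\mathcal{S})=\sup\{p: I_p(\Omega^* )<\infty\}$, and $\mathfrak{m}(\mathcal{S})=\max\{\mathfrak{m}^+(\mathcal{S}),\mathfrak{m}^-(\mathcal{S})\}$. *)

(* Defs.v *)
From HB Require Import structures.
From mathcomp Require Import all_boot all_order all_algebra.
From mathcomp Require Import all_classical all_reals all_analysis.
From mathcomp Require Import ring.

Set Implicit Arguments.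
Unset Strict Implicit.
Unset Printing Implicit Defensive.

Import Order.TTheory GRing.Theory Num.Theory.
Import numFieldNormedType.Exports.

Local Open Scope ring_scope.

Definition l2norm {R : realType} {I : finType} (f : I -> R) : R :=
  Num.sqrt (\sum_i f i ^+ 2).

Section l2norm_theory.
Context {R : realType} {I : finType}.
Implicit Types f g : I -> R.

Let sumsq_ge0 f : 0 <= \sum_i f i ^+ 2.
Proof. by apply: sumr_ge0 => i _; exact: sqr_ge0. Qed.

Lemma l2norm_eq0 f : l2norm f = 0 -> forall i, f i = 0.
Proof.
move=> /eqP; rewrite sqrtr_eq0 => f0 i.
have /eqP : \sum_i f i ^+ 2 = 0 by apply/eqP; rewrite eq_le f0 sumsq_ge0.
rewrite psumr_eq0 => [/allP/(_ i)|j _]; last exact: sqr_ge0.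
by rewrite mem_index_enum sqrf_eq0 => /(_ isT) /eqP.
Qed.

Lemma l2normZ (l : R) f : l2norm (fun i => l * f i) = `|l| * l2norm f.
Proof.
rewrite /l2norm; under eq_bigr do rewrite exprMn.
by rewrite -mulr_sumr sqrtrM ?sqr_ge0// sqrtr_sqr.
Qed.

Lemma l2norm_cauchy f g : \sum_i f i * g i <= l2norm f * l2norm g.
Proof.
rewrite (le_trans (ler_norm _))// -sqrtrM// -sqrtr_sqr ler_sqrt; last first.
  by rewrite mulr_ge0.
have : 0 <= \sum_i \sum_j (f i * g j - f j * g i) ^+ 2.
  by do 2!apply: sumr_ge0 => ? _; exact: sqr_ge0.
have -> : \sum_i \sum_j (f i * g j - f j * g i) ^+ 2 =
    ((\sum_i f i ^+ 2) * (\sum_i g i ^+ 2) - (\sum_i f i * g i) ^+ 2) *+ 2.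
  transitivity (\sum_i \sum_j (f i ^+ 2 * g j ^+ 2 + g i ^+ 2 * f j ^+ 2
      - (f i * g i) * (f j * g j) *+ 2)).
    by apply: eq_bigr => i _; apply: eq_bigr => j _; ring.
  under eq_bigr do rewrite sumrB big_split /= sumrMnl -!mulr_sumr.
  rewrite sumrB big_split /= sumrMnl -!mulr_suml; ring.
by rewrite pmulrn_lge0// subr_ge0.
Qed.

Lemma l2normD f g : l2norm (fun i => f i + g i) <= l2norm f + l2norm g.
Proof.
rewrite -(@ler_pXn2r _ 2)// ?nnegrE ?addr_ge0 ?sqrtr_ge0// sqrrD.
rewrite !sqr_sqrtr//; under eq_bigr do rewrite sqrrD.
rewrite big_split lerD2r big_split lerD2l sumrMnl lerMn2r /=.
exact: l2norm_cauchy.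
Qed.

End l2norm_theory.

(* The norm of 'rV[R]_n in the library is the sup norm, which induces the same
   topology; metric notions below use the Euclidean norm. *)
Definition enorm {R : realType} {n : nat} (x : 'rV[R]_n) : R := l2norm (x ord0).

(* An element a is the family of its coordinates a A on the basis e_A. *)
Definition clifford (R : realType) (n : nat) := {ffun {set 'I_n} -> R}.

Section clifford_algebra.
Context {R : realType} {n : nat}.
Local Notation cl := (clifford R n).
Local Notation set0 := (@finset.set0 'I_n).
Implicit Types (a b c : cl) (A B C D X : {set 'I_n}).

HB.instance Definition _ := GRing.Lmodule.copy cl {ffun {set 'I_n} -> R^o}.

Definition symdiff A B : {set 'I_n} := (A :\: B) :|: (B :\: A).

(* Sorting e_A e_B costs a sign for each (i, j) in A x B with j < i, and each
   square e_i e_i = -1 one more; what is left is e_(symdiff A B). *)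
Definition clsign A B : R := \prod_(i in A) \prod_(j in B | (j <= i)%N) (-1).

Definition clbasis A : cl := [ffun B => (B == A)%:R].

(* The bilinear extension of e_A e_B = clsign A B e_(symdiff A B). *)
Definition clmul a b : cl :=
  [ffun C => \sum_A clsign A (symdiff A C) * a A * b (symdiff A C)].

Lemma in_symdiff i A B : (i \in symdiff A B) = (i \in A) (+) (i \in B).
Proof. by rewrite !inE; do 2!case: (_ \in _). Qed.

Lemma symdiffC A B : symdiff A B = symdiff B A.
Proof. by apply/setP => i; rewrite !in_symdiff addbC. Qed.

Lemma symdiffA A B C : symdiff A (symdiff B C) = symdiff (symdiff A B) C.
Proof. by apply/setP => i; rewrite !in_symdiff addbA. Qed.

Lemma symdiffK A B : symdiff A (symdiff A B) = B.
Proof. by apply/setP => i; rewrite !in_symdiff addKb. Qed.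

Lemma symdiff0 A : symdiff A set0 = A.
Proof. by apply/setP => i; rewrite in_symdiff inE addbF. Qed.

Lemma symdiffxx A : symdiff A A = set0.
Proof. by apply/setP => i; rewrite in_symdiff addbb inE. Qed.

Let prod_symdiff (P : pred 'I_n) (f : 'I_n -> R) A B :
  (forall i, f i * f i = 1) ->
  \prod_(i in symdiff A B | P i) f i =
  (\prod_(i in A | P i) f i) * (\prod_(i in B | P i) f i).
Proof.
move=> ff; rewrite big_mkcond [X in _ = X * _]big_mkcond.
rewrite [X in _ = _ * X]big_mkcond -big_split /=; apply: eq_bigr => i _.
rewrite in_symdiff; case: (P i); rewrite ?andbF ?mulr1// !andbT.
by do 2!case: (_ \in _); rewrite /= ?mulr1 ?mul1r ?ff.
Qed.

Lemma clsignDl A B C : clsign (symdiff A B) C = clsign A C * clsign B C.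
Proof.
have := @prod_symdiff xpredT (fun i => \prod_(j in C | (j <= i)%N) (-1)) A B.
rewrite /clsign !(eq_bigl _ _ (fun _ => andbT _)); apply => i.
by rewrite -big_split /= big1// => j _; rewrite mulrNN mulr1.
Qed.

Lemma clsignDr A B C : clsign A (symdiff B C) = clsign A B * clsign A C.
Proof.
rewrite /clsign -big_split; apply: eq_bigr => i _ /=.
by apply: prod_symdiff => j; rewrite mulrNN mulr1.
Qed.

Lemma clsign_sq A B : clsign A B * clsign A B = 1.
Proof. by rewrite -clsignDl symdiffxx /clsign big_set0. Qed.

Lemma clsign0l A : clsign set0 A = 1.
Proof. by rewrite /clsign big_set0. Qed.

Lemma clsign0r A : clsign A set0 = 1.
Proof. by rewrite /clsign big1// => i _; rewrite big1// => j; rewrite inE. Qed.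

Lemma clmulA : associative clmul.
Proof.
move=> a b c; apply/ffunP => D; rewrite !ffunE.
under eq_bigr do rewrite ffunE mulr_sumr.
under [RHS]eq_bigr do rewrite ffunE mulr_sumr mulr_suml.
rewrite [RHS]exchange_big; apply: eq_bigr => A _ /=.
rewrite (reindex_inj (can_inj (symdiffK A))); apply: eq_bigr => E _ /=.
have -> : symdiff (symdiff A E) (symdiff A D) = symdiff E D.
  by rewrite (symdiffC A E) -symdiffA symdiffK.
have -> : clsign (symdiff A E) (symdiff E D) =
    clsign A (symdiff E D) * clsign E (symdiff E D) by rewrite clsignDl.
have -> : clsign A (symdiff A D) =
    clsign A (symdiff A E) * clsign A (symdiff E D).
  by rewrite -clsignDr -symdiffA symdiffK.
set s1 := clsign A (symdiff A E); set s2 := clsign A (symdiff E D).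
set s3 := clsign E _.
have s22 : s2 * s2 = 1 by exact: clsign_sq.
ring: s22.
Qed.

Lemma clmul1l : left_id (clbasis set0) clmul.
Proof.
move=> a; apply/ffunP => C; rewrite ffunE (bigD1 set0)//= big1.
  by rewrite ffunE eqxx addr0 clsign0l !mul1r symdiffC symdiff0.
by move=> A A0; rewrite ffunE (negbTE A0) mulr0 mul0r.
Qed.

Lemma clmul1r : right_id (clbasis set0) clmul.
Proof.
move=> a; apply/ffunP => C; rewrite ffunE (bigD1 C)//= big1.
  by rewrite symdiffxx ffunE eqxx addr0 clsign0r mul1r mulr1.
move=> A AC; rewrite ffunE; case: eqP => [AC0|]; last by rewrite mulr0.
by move: AC; rewrite -(symdiffK A C) AC0 symdiff0 eqxx.
Qed.

Lemma clmulDl : left_distributive clmul +%R.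
Proof.
move=> a b c; apply/ffunP => C; rewrite !ffunE -big_split /=.
by apply: eq_bigr => A _; rewrite ffunE mulrDr mulrDl.
Qed.

Lemma clmulDr : right_distributive clmul +%R.
Proof.
move=> a b c; apply/ffunP => C; rewrite !ffunE -big_split /=.
by apply: eq_bigr => A _; rewrite ffunE mulrDr.
Qed.

Lemma clbasis0_neq0 : clbasis set0 != 0.
Proof.
apply/eqP => /ffunP/(_ set0); rewrite !ffunE eqxx => /eqP.
by rewrite oner_eq0.
Qed.

HB.instance Definition _ := GRing.Zmodule_isNzRing.Build cl
  clmulA clmul1l clmul1r clmulDl clmulDr clbasis0_neq0.

Lemma clscaleAl (k : R) a b : k *: (a * b) = (k *: a) * b.
Proof.
apply/ffunP => C; rewrite !ffunE scaler_sumr; apply: eq_bigr => A _.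
by rewrite !ffunE /GRing.scale /= !mulrA (mulrC k).
Qed.

Lemma clscaleAr (k : R) a b : k *: (a * b) = a * (k *: b).
Proof.
apply/ffunP => C; rewrite !ffunE scaler_sumr; apply: eq_bigr => A _.
by rewrite !ffunE /GRing.scale /= mulrCA.
Qed.

HB.instance Definition _ := GRing.Lmodule_isLalgebra.Build R cl clscaleAl.
HB.instance Definition _ := GRing.Lalgebra_isAlgebra.Build R cl clscaleAr.

Lemma clnormD a b : l2norm (a + b : cl) <= l2norm a + l2norm b.
Proof.
apply: le_trans (l2normD _ _); rewrite le_eqVlt; apply/orP; left; apply/eqP.
by congr l2norm; apply/funext => A; rewrite ffunE.
Qed.

Lemma clnormZ (k : R) a : l2norm (k *: a : cl) = `|k| * l2norm a.
Proof.
by rewrite -l2normZ; congr l2norm; apply/funext => A; rewrite ffunE.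
Qed.

Lemma clnorm0_eq0 a : l2norm a = 0 -> a = 0.
Proof. by move=> /l2norm_eq0 a0; apply/ffunP => A; rewrite ffunE a0. Qed.

HB.instance Definition _ := Lmodule_isNormed.Build R cl
  clnormD clnormZ clnorm0_eq0.

Lemma clnormE a : `|a| = l2norm a. Proof. by []. Qed.

Definition clgen (j : 'I_n) : cl := clbasis [set j].

Lemma clbasisM A B : clbasis A * clbasis B = clsign A B *: clbasis (symdiff A B).
Proof.
apply/ffunP => C; rewrite !ffunE (bigD1 A)//= big1 ?addr0; last first.
  by move=> D DA; rewrite ffunE (negbTE DA) mulr0 mul0r.
rewrite !ffunE eqxx mulr1 /GRing.scale /=.
have -> : (symdiff A C == B) = (C == symdiff A B).
  by apply/eqP/eqP => [<-|->]; rewrite symdiffK.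
by case: eqP => [->|]; rewrite ?symdiffK// !mulr0.
Qed.

Lemma clgen_anticomm (i j : 'I_n) :
  clgen i * clgen j + clgen j * clgen i = - (2 * (i == j)%:R) *: 1.
Proof.
have sgnE (k l : 'I_n) : clsign [set k] [set l] = (-1) ^+ (l <= k)%N.
  rewrite /clsign big_set1; case: leqP => lk.
    rewrite (big_pred1 l)// => m; rewrite inE /=.
    by have [->|//] := eqVneq m l; rewrite lk.
  by rewrite big1// => m /andP[/set1P ->]; rewrite leqNgt lk.
rewrite !clbasisM !sgnE; case: (ltngtP i j) => ij.
- have /negbTE -> : i != j by rewrite neq_ltn ij.
  by rewrite expr0 expr1 symdiffC mulr0 oppr0 scale0r -scalerDl subrr scale0r.
- have /negbTE -> : i != j by rewrite neq_ltn ij orbT.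
  by rewrite expr0 expr1 symdiffC mulr0 oppr0 scale0r -scalerDl addNr scale0r.
- have -> : i = j by exact/val_inj.
  by rewrite eqxx symdiffxx -scalerDl expr1 mulr1 -opprD.
Qed.

Lemma clbasis_gen A : clbasis A = \prod_(j < n | j \in A) clgen j.
Proof.
have gen (s : seq 'I_n) : sorted ltn (map val s) ->
    \prod_(j <- s | j \in A) clgen j = clbasis [set j in s | j \in A].
  elim: s => [_|i s IHs /= sis].
    rewrite big_nil -[LHS]/(clbasis set0); congr clbasis.
  have {}IHs := IHs (path_sorted sis).
  have /allP ltis := order_path_min ltn_trans sis.
  rewrite big_cons IHs; case: ifPn => iA.
    rewrite clbasisM [clsign _ _]big_set1 big1 ?scale1r => [|j]; last first.
      rewrite inE => /andP[/andP[js _]].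
      by rewrite leqNgt; have := ltis _ (map_f val js) => /= ->.
    congr clbasis; apply/setP => j; rewrite in_symdiff !inE.
    have [->|_] := eqVneq j i; rewrite /= ?iA //.
    rewrite andbT; case: (boolP (i \in s)) => // si.
    by have := ltis _ (map_f val si); rewrite /= ltnn.
  congr clbasis; apply/setP => j; rewrite !inE.
  by have [->|_] := eqVneq j i; rewrite //= (negbTE iA) andbF.
transitivity (\prod_(j <- enum 'I_n | j \in A) clgen j).
  rewrite gen; last by rewrite val_enum_ord iota_ltn_sorted.
  by congr clbasis; apply/setP => j; rewrite inE mem_enum.
rewrite -big_filter -[RHS]big_filter deprecated_filter_index_enum.
by rewrite enumT.
Qed.

End clifford_algebra.

Local Open Scope classical_set_scope.

(* The infimum of the sums of the weights w of the at most countable families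
   of admissible (i.e., in P) indices whose sets B cover A. *)
Definition cover_inf {R : realType} {T J : Type} (P : set J) (B : J -> set T)
    (w : J -> \bar R) (A : set T) : \bar R :=
  ereal_inf [set s | exists I (F : nat -> J), [/\ forall k, I k -> P (F k),
    A `<=` \bigcup_(k in I) B (F k) & s = (\esum_(k in I) w (F k))%E]].

Section cover_outer_measure.
Context {R : realType} {T J : Type} (P : set J) (B : J -> set T).
Context (w : J -> \bar R) (w_ge0 : forall j, P j -> (0 <= w j)%E).
Context (j0 : J).
Local Open Scope ereal_scope.
Local Notation mu := (cover_inf P B w).

Lemma cover_inf_ge0 A : 0 <= mu A.
Proof.
apply: le_ereal_inf_tmp => _ [I [F [PF _ ->]]].
by apply: esum_ge0 => k Ik; apply/w_ge0/PF.
Qed.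

Lemma cover_inf0 : mu set0 = 0.
Proof.
apply/eqP; rewrite eq_le cover_inf_ge0 andbT; apply: ereal_inf_lbound.
by exists set0, (fun=> j0); split => //; rewrite esum_set0.
Qed.

Lemma le_cover_inf : {homo mu : A A' / A `<=` A' >-> A <= A'}.
Proof.
move=> A A' AA'; apply: ereal_inf_le_tmp => _ [I [F [PF A'F ->]]].
by exists I, F; split => //; exact: subset_trans A'F.
Qed.

Lemma cover_inf_sigma_subadditive : sigma_subadditive mu.
Proof.
move=> A; have [[i ioo]|] := pselect (exists i, mu (A i) = +oo).
  rewrite (eseries_pinfty _ _ ioo) ?leey// => n _.
  by rewrite -ltNye (lt_le_trans _ (cover_inf_ge0 _)).
rewrite -forallNE => Aoo.
suff add2e (e : {posnum R}) :
    mu (\bigcup_n A n) <= \sum_(i <oo) mu (A i) + e%:num%:E.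
  by apply/lee_addgt0Pr => _/posnumP[].
rewrite (le_trans _ (epsilon_trick _ _ _))//; last first.
  by move=> n; exact: cover_inf_ge0.
pose Q n (IF : set nat * (nat -> J)) := [/\ forall k, IF.1 k -> P (IF.2 k),
  A n `<=` \bigcup_(k in IF.1) B (IF.2 k) &
  \esum_(k in IF.1) w (IF.2 k) <= mu (A n) + (e%:num / (2 ^ n.+1)%:R)%:E].
have [G QG] : {G : nat -> set nat * (nat -> J) & forall n, Q n (G n)}.
  apply: (@choice _ _ Q) => n.
  have fin : mu (A n) \is a fin_num.
    by rewrite ge0_fin_numE ?cover_inf_ge0// lt_neqAle leey andbT; apply/eqP.
  have en1 : (0 < e%:num / (2 ^ n.+1)%:R :> R)%R by [].
  have [_ [I [F [PF AF ->]]] /ltW] := lb_ereal_inf_adherent en1 fin.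
  by exists (I, F).
pose K := [set: nat] `*`` (fun i => (G i).1).
pose v (p : nat * nat) := (G p.1).2 p.2.
have Kw p : K p -> 0 <= w (v p).
  by move=> [_ Gp]; apply/w_ge0; have [+ _ _] := QG p.1; apply.
apply: (@le_trans _ _ (\esum_(p in K) w (v p))).
  pose F k := v (odflt (0, 0)%N (unpickle k)).
  have FE p : F (pickle p) = v p by rewrite /F pickleK.
  apply: ereal_inf_lbound; exists (pickle @` K), F; split.
  - move=> _ [p [_ Gp] <-]; rewrite FE.
    by have [+ _ _] := QG p.1; apply.
  - move=> x [n _ Anx]; have [_ /(_ x Anx)[k Gk Bx] _] := QG n.
    by exists (pickle (n, k)); [exists (n, k) | rewrite FE].
  - rewrite (reindex_esum K _ (@pickle (nat * nat)%type)).
      by apply: eq_esum => p _; rewrite FE.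
    apply: inj_bij => p q _ _; exact: (pcan_inj pickleK).
rewrite -(esum_esum (a := fun i j => w ((G i).2 j))); last first.
  by move=> i j _ Gij; exact: (Kw (i, j)).
rewrite -nneseries_esumT; last first.
  by move=> n; apply: esum_ge0 => k Gk; exact: (Kw (n, k)).
apply: lee_nneseries => n.
  by move=> _ _; apply: esum_ge0 => k Gk; exact: (Kw (n, k)).
by move=> _; have [] := QG n.
Qed.

End cover_outer_measure.

Section lebesgue.
Context {R : realType} {n : nat}.
Local Notation Rn := 'rV[R]_n.

Definition box (ab : Rn * Rn) : set Rn :=
  [set x : Rn | forall i, ab.1 ord0 i <= x ord0 i <= ab.2 ord0 i].

Definition box_volume (ab : Rn * Rn) : \bar R :=
  (\prod_i (ab.2 ord0 i - ab.1 ord0 i))%:E.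

Definition proper_box : set (Rn * Rn) :=
  [set ab : Rn * Rn | forall i, ab.1 ord0 i <= ab.2 ord0 i].

Definition lebesgue_outer : set Rn -> \bar R :=
  cover_inf proper_box box box_volume.

Let box_volume_ge0 ab : proper_box ab -> (0 <= box_volume ab)%E.
Proof. by move=> abP; rewrite lee_fin prodr_ge0// => i _; rewrite subr_ge0. Qed.

HB.instance Definition _ := isOuterMeasure.Build R Rn lebesgue_outer
  (cover_inf0 box box_volume_ge0 (0, 0)) (cover_inf_ge0 box box_volume_ge0)
  (@le_cover_inf _ _ _ _ _ _)
  (cover_inf_sigma_subadditive box box_volume_ge0).

Definition lebesgue_outer_measure : {outer_measure set Rn -> \bar R} :=
  lebesgue_outer.

(* n-dimensional Lebesgue measure, on the Caratheodory (i.e., Lebesgue)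
   measurable sets. *)
Definition lebesgue_rV :
    {measure set (caratheodory_type lebesgue_outer_measure) -> \bar R} :=
  lebesgue_outer_measure.

End lebesgue.

Section hausdorff.
Context {R : realType} {n : nat}.
Local Notation Rn := 'rV[R]_n.
Implicit Types A E : set Rn.

Definition diam_le (d : R) : set (set Rn) :=
  [set E : set Rn | forall x y, E x -> E y -> enorm (x - y) <= d].

Definition diameter E : R := sup [set enorm (p.1 - p.2) | p in E `*` E].

Definition hausdorff_premeasure (s d : R) A : \bar R :=
  cover_inf (diam_le d) id (fun E => (diameter E `^ s)%:E) A.

Definition hausdorff_measure (s : R) A : \bar R :=
  ereal_sup [set hausdorff_premeasure s d A | d in [set d | 0 < d]].

Definition hausdorff_dim A : \bar R :=
  ereal_inf [set s%:E | s in [set s | 0 <= s /\ hausdorff_measure s A = 0%E]].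

End hausdorff.

Section domains.
Context {R : realType} {n : nat}.
Local Notation Rn := 'rV[R]_n.
Implicit Types S Om D : set Rn.

(* Locally homeomorphic to R^(n-1), for the topology induced by R^n. *)
Definition topological_hypersurface S := forall x, S x ->
  exists U : set Rn, [/\ open U, U x &
  exists (f : Rn -> 'rV[R]_n.-1) (h : 'rV[R]_n.-1 -> Rn),
    [/\ {within U `&` S, continuous f}, continuous h,
        forall y, (U `&` S) (h y), cancel h f &
        forall z, (U `&` S) z -> h (f z) = z]].

Definition boundary D : set Rn := closure D `\` D°.

Definition jordan_domain Om :=
  [/\ Om !=set0, open Om, connected Om & bounded_set Om] /\
  (compact (boundary Om) /\ topological_hypersurface (boundary Om)).

Definition outer_domain S Om : set Rn := ~` (Om `|` S).

Definition eball (r : R) : set Rn := [set x : Rn | enorm x < r].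

Definition edist S (x : Rn) : R := inf [set enorm (x - y) | y in S].

Definition dist_integral S (p : R) D : \bar R :=
  (\int[lebesgue_rV]_(x in D) (edist S x `^ (- p))%:E)%E.

Definition marcinkiewicz_on S D : \bar R :=
  ereal_sup [set p%:E | p in [set p | (dist_integral S p D < +oo)%E]].

(* r is the radius of a ball containing S; its choice is immaterial. *)
Definition marcinkiewicz S Om (r : R) : \bar R :=
  Order.max (marcinkiewicz_on S Om)
            (marcinkiewicz_on S (outer_domain S Om `&` eball r)).

End domains.

Section monogenic.
Context {R : realType} {n : nat}.
Local Notation Rn := 'rV[R]_n.
Local Notation cl := (clifford R n).
Implicit Types (u : Rn -> cl) (U E S Om : set Rn) (c : cl).

Definition partial (j : 'I_n) u (x : Rn) : cl := 'D_(delta_mx ord0 j) u x.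

Definition C1_on U u := forall j x, U x ->
  derivable u x (delta_mx ord0 j) /\ {for x, continuous (partial j u)}.

Definition dirac_op u (x : Rn) : cl := \sum_j clgen j * partial j u x.

Definition monogenic_on U u := C1_on U u /\ forall x, U x -> dirac_op u x = 0.

Definition holder_on (nu : R) E u := exists M : R, forall x y, E x -> E y ->
  `|u x - u y| <= M * enorm (x - y) `^ nu.

Definition limit_at_infinity u c := forall e : R, 0 < e ->
  exists r : R, forall x, r < enorm x -> `|u x - c| < e.

Definition continuous_extension Om u ue :=
  {within closure Om, continuous ue} /\ forall x, Om x -> ue x = u x.

(* Phi is a function on the complement of S (its values on S are irrelevant),
   with extensions Phip and Phim to the closures of the two domains. *)
Definition jump_solution S Om (g : Rn -> cl) c (Phi Phip Phim : Rn -> cl) :=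
  [/\ monogenic_on (~` S) Phi,
      continuous_extension Om Phi Phip,
      continuous_extension (outer_domain S Om) Phi Phim,
      forall x, S x -> Phip x - Phim x = g x &
      limit_at_infinity Phi c].

End monogenic.

(* Main.v *)
Require Import Defs.
From mathcomp Require Import all_boot all_order all_algebra.
From mathcomp Require Import all_classical all_reals all_analysis.
From mathcomp Require Import ring lra.

(** The difference of two solutions extends to a function w on R^n which is
continuous across S, tends to 0 at infinity, is monogenic off S, and satisfies
a Hoelder condition with an exponent k >= 0 such that S has Hausdorff dimension
< n - 1 + k. Each component of the Dirac equation says that some vector field
v is divergence free off S. The flux of v out of a cube of side h is
O(h^(n-1+k)) near S and o(h^n) away from S; bisecting cubes against a covering
of S by balls with small sum of r^(n-1+k) shows that it is 0 for every cube.

For fixed h, averaging w over the cubes x + [0, h]^n turns partial derivatives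
into differences X_j of averages over opposite faces, so this vanishing reads
\sum_j e_j X_j w = 0, whence \sum_j X_j^2 w = 0 as the X_j commute. The double
cube average of w is therefore harmonic; it tends to 0 at infinity, so it is 0
by the maximum principle. Letting h tend to 0 gives w = 0. *)

Set Implicit Arguments.
Unset Strict Implicit.
Unset Printing Implicit Defensive.

Import Order.TTheory GRing.Theory Num.Theory.
Import numFieldNormedType.Exports.

Local Open Scope classical_set_scope.
Local Open Scope ring_scope.

Local Notation "''e_' i" := (delta_mx ord0 i : 'rV_ _) (at level 8, i at level 2).

(** [S] may carry no finite surface measure, so Stokes' theorem and the Cauchy integral are not at
    hand on it; only integrals over faces of axis-parallel cubes occur. They are iterated
    one-dimensional averages, defined through antiderivatives, and the commutation of these averages
    does the work of Fubini's theorem.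

    The exponent n-1+k is the cost of a ball of radius r: an area r^(n-1) times an oscillation r^k
    of w. Instead of counting cubes that meet a ball, the flux is compared with a function of cubes
    that is additive under bisection, so that one bound at some scale around each point is enough.

    Working with X_j at a fixed h avoids any regularity theory for w: each cube average gains one
    derivative along every axis, so two of them make the second derivatives along the axes
    meaningful although w is only continuous on S. *)

(** * Antiderivatives of continuous functions on the line *)

Section antiderivative.
Context {R : realType}.
Implicit Types (f F G : R -> R) (a b x y : R).

Definition antiderivative F f := forall x, is_derive x (1 : R) F (f x).

Lemma antiderivative_MVT F f a b : antiderivative F f -> a <= b ->
  exists2 c, a <= c <= b & F b - F a = f c * (b - a).
Proof.
move=> Ff ab.
have [|c cab ->] := @MVT_segment R F f a b ab (fun x _ => Ff x).
  by apply: derivable_within_continuous => x _; apply: ex_derive.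
by exists c => //; move: cab; rewrite in_itv.
Qed.

Lemma antiderivative_const_sub F G f x y : antiderivative F f ->
  antiderivative G f -> F x - F y = G x - G y.
Proof.
move=> Ff Gf.
suff : (F - G) x = (F - G) y by rewrite !fctE; lra.
apply: is_derive_0_is_cst => z; rewrite -(subrr (f z)).
exact: is_deriveB.
Qed.

Let I f b x := Rintegral lebesgue_measure `[b, x] f.

Let I_derive f b x : continuous f -> b < x -> is_derive x (1 : R) (I f b) (f x).
Proof.
move=> cf bx.
have x1 : x < x + 1 by rewrite ltrDl.
have int : lebesgue_measure.-integrable `[b, x + 1] (EFin \o f).
  apply: continuous_compact_integrable; first exact: segment_compact.
  exact: continuous_subspaceT.
have [dF <-] := continuous_FTC1_closed x1 int bx (cf x).
by rewrite derive1E; apply: DeriveDef.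
Qed.

(** For x <= y, the difference of the two integrals has derivative 0 to the right of x. This allows
    the base point to move. *)
Let I_indep f b c x y : continuous f -> b < x -> b < y -> c < x -> c < y ->
  I f b x - I f b y = I f c x - I f c y.
Proof.
move=> cf bx byy cx cy.
wlog xy : x y bx byy cx cy / x <= y.
  move=> W; have [/W->//|/ltW/W yx] := leP x y.
  by rewrite -opprB yx// opprB.
pose D z := I f b z - I f c z.
have dD z : x <= z -> is_derive z (1 : R) D 0.
  move=> xz; rewrite -(subrr (f z)).
  by apply: is_deriveB; apply: I_derive => //; apply: lt_le_trans xz.
have cD : {within `[x, y], continuous D}.
  apply: derivable_within_continuous => z; rewrite in_itv/= => /andP[xz _].
  by have := dD z xz => Dz; apply: ex_derive.
have dD' z : z \in `]x, y[ -> is_derive z (1 : R) D 0.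
  by rewrite in_itv/= => /andP[/ltW xz _]; exact: dD.
have [d _] := MVT_segment xy dD' cD.
rewrite mul0r /D => DD; lra.
Qed.

(** [I_derive] needs a base point to the left of x, so no fixed base point serves the whole line:
    [base x] moves with x and stays left of both x and 0. Near x, [I_indep] replaces it by a fixed
    one. *)
Lemma continuous_antiderivative f : continuous f ->
  exists F, antiderivative F f.
Proof.
move=> cf; pose base x := Num.min x 0 - 1.
have bx x : base x < x by rewrite /base; case: (leP x 0) => ?; lra.
have b0 x : base x < 0 by rewrite /base; case: (leP x 0) => ?; lra.
exists (fun x => I f (base x) x - I f (base x) 0) => x.
have bb : base x - 1 < x by have := bx x; lra.
have bb0 : base x - 1 < 0 by have := b0 x; lra.
pose G y := I f (base x - 1) y - I f (base x - 1) 0.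
apply: (@near_eq_is_derive _ _ _ G).
  near=> y; have yb : base x - 1 < y.
    by near: y; exact: lt_nbhsr.
  by apply: I_indep.
rewrite -[f x]subr0.
by apply: is_deriveB; exact: I_derive.
Unshelve. all: end_near. Qed.

End antiderivative.

(** * Averages along the coordinate axes *)

Section averages.
Context {R : realType} {n : nat}.
Local Notation Rn := 'rV[R]_n.
Implicit Types (f g : Rn -> R) (x y v : Rn) (i j : 'I_n) (h t c e : R).

(** Uniformity matters because averaging preserves it, with the same d for each e, so averages can
    be iterated. *)
Definition ucont f := forall e, 0 < e -> exists2 d, 0 < d &
  forall x y, (forall i, `|x ord0 i - y ord0 i| < d) -> `|f x - f y| <= e.

Lemma rowD_delta x t i k :
  (x + t *: 'e_i) ord0 k = x ord0 k + t * (k == i)%:R.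
Proof. by rewrite !mxE eqxx. Qed.

Lemma ucont_line f i x : ucont f -> continuous (fun t => f (x + t *: 'e_i)).
Proof.
move=> uf t; apply/cvgrPdist_le => /= e /uf[d d0 fd]; near=> s.
apply: fd => k; rewrite !rowD_delta opprD addrACA subrr add0r -mulrBl.
rewrite normrM; apply: (@le_lt_trans _ _ `|t - s|).
  by rewrite ler_piMr// ger0_norm ?ler0n// lern1 leq_b1.
by near: s; exists d.
Unshelve. all: end_near. Qed.

Lemma ucontD f g a b : ucont f -> ucont g -> ucont (fun x => a * f x + b * g x).
Proof.
move=> uf ug e e0; pose m := `|a| + `|b| + 1.
have m0 : 0 < m by rewrite ltr_wpDl// addr_ge0.
have [|d1 d10 fd] := uf (e / m); first by rewrite divr_gt0.
have [|d2 d20 gd] := ug (e / m); first by rewrite divr_gt0.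
exists (Num.min d1 d2) => [|x y xy]; first by rewrite lt_min d10.
have {}fd : `|f x - f y| <= e / m.
  by apply: fd => i; rewrite (lt_le_trans (xy i))// ge_min lexx.
have {}gd : `|g x - g y| <= e / m.
  by apply: gd => i; rewrite (lt_le_trans (xy i))// ge_min lexx orbT.
have -> : a * f x + b * g x - (a * f y + b * g y) =
  a * (f x - f y) + b * (g x - g y) by ring.
rewrite (le_trans (ler_normD _ _))// !normrM.
apply: (@le_trans _ _ ((`|a| + `|b|) * (e / m))).
  by rewrite mulrDl lerD// ler_wpM2l.
have em : m * (e / m) = e by rewrite mulrC divfK// gt_eqF.
rewrite -[leRHS]em ler_wpM2r//; first by rewrite divr_ge0// ltW.
by rewrite /m lerDl.
Qed.

Lemma ucont_trans f v : ucont f -> ucont (fun x => f (x + v)).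
Proof.
move=> uf e /uf[d d0 fd]; exists d => // x y xy; apply: fd => i.
by rewrite !mxE opprD addrACA subrr addr0.
Qed.

Lemma ucont_cst c : ucont (fun=> c).
Proof. by move=> e e0; exists 1 => // x y _; rewrite subrr normr0 ltW. Qed.

(** The mean of phi over [0, h]. By [avg1E] any antiderivative computes it, which reduces linearity,
    translation and doubling to algebra on antiderivatives. *)
Definition avg1 h (phi : R -> R) : R :=
  let F := xget (fun=> 0) [set F | antiderivative F phi] in h^-1 * (F h - F 0).

Lemma avg1E h phi G : antiderivative G phi -> avg1 h phi = h^-1 * (G h - G 0).
Proof.
move=> GP; rewrite /avg1; case: xgetP => [F _ FP|/(_ G)//].
by congr (_ * _); exact: antiderivative_const_sub FP GP.
Qed.

Definition avg h i f x : R := avg1 h (fun t => f (x + t *: 'e_i)).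

Lemma antiderivative_shift (F : R -> R) phi s : antiderivative F phi ->
  antiderivative (fun t => F (s + t)) (fun t => phi (s + t)).
Proof.
move=> FP t; have Fst := FP (s + t).
have dst : is_derive t (1 : R) (fun t => s + t) 1.
  by rewrite -[X in is_derive _ _ _ X]add0r; apply: is_deriveD.
have := is_derive1_comp Fst dst.
by rewrite mulr1.
Qed.

Lemma ucont_antiderivative f i x : ucont f ->
  exists G, antiderivative G (fun t => f (x + t *: 'e_i)).
Proof. by move=> uf; apply/continuous_antiderivative/ucont_line. Qed.

Lemma avg_shift h i f x t G : antiderivative G (fun t => f (x + t *: 'e_i)) ->
  avg h i f (x + t *: 'e_i) = h^-1 * (G (t + h) - G t).
Proof.
move=> /(antiderivative_shift t) GP; rewrite /avg.
rewrite (_ : (fun _ => _) = (fun s => f (x + (t + s) *: 'e_i))).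
  by rewrite (avg1E _ GP) addr0.
by apply/funext => s; rewrite scalerDl addrA.
Qed.

Lemma avgE h i f x G : antiderivative G (fun t => f (x + t *: 'e_i)) ->
  avg h i f x = h^-1 * (G h - G 0).
Proof. exact: avg1E. Qed.

Lemma avg_trans h i f x v : avg h i (fun y => f (y + v)) x = avg h i f (x + v).
Proof. by congr avg1; apply/funext => t; rewrite addrAC. Qed.

Lemma avg_MVT h i f x : ucont f -> 0 < h ->
  exists2 t, 0 <= t <= h & avg h i f x = f (x + t *: 'e_i).
Proof.
move=> uf h0; have [G GP] := ucont_antiderivative i x uf.
have [t th GE] := antiderivative_MVT GP (ltW h0); exists t => //.
by rewrite (avgE _ GP) GE subr0 mulrCA mulVf ?mulr1// gt_eqF.
Qed.

Lemma avgD h i f g a b x : ucont f -> ucont g ->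
  avg h i (fun x => a * f x + b * g x) x = a * avg h i f x + b * avg h i g x.
Proof.
move=> uf ug; have [F FP] := ucont_antiderivative i x uf.
have [G GP] := ucont_antiderivative i x ug.
rewrite (avgE _ FP) (avgE _ GP) (@avgE _ _ _ _ (fun t => a * F t + b * G t)).
  ring.
move=> t; have Ft := FP t; have Gt := GP t.
by apply: is_deriveD; apply: is_deriveZ.
Qed.

(** A difference of averages is the average of f minus a translate of f, hence by the mean value
    property one of its values. *)
Lemma avg_ucont h i f : 0 < h -> ucont f -> ucont (avg h i f).
Proof.
move=> h0 uf e /uf[d d0 fd]; exists d => // x y xy.
have -> : avg h i f x - avg h i f y =
    avg h i (fun z => 1 * f (z + (x - y)) + (-1) * f z) y.
  rewrite avgD//; last exact: ucont_trans.
  by rewrite avg_trans (addrC y) subrK; ring.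
have [t _ ->] := avg_MVT i y (ucontD 1 (-1) (ucont_trans (x - y) uf) uf) h0.
rewrite mul1r mulN1r; apply: fd => k; rewrite !mxE.
by have := xy k; congr (`| _ | < _); ring.
Qed.

Lemma avg_double h i f x : ucont f ->
  avg (2 * h) i f x = 2^-1 * (avg h i f x + avg h i f (x + h *: 'e_i)).
Proof.
move=> uf; have [G GP] := ucont_antiderivative i x uf.
by rewrite (avg_shift _ _ GP) !(avgE _ GP) invfM mulr_natl mulr2n; ring.
Qed.

Lemma avg_derive h i f x t : ucont f ->
  is_derive t (1 : R) (fun t => avg h i f (x + t *: 'e_i))
    (h^-1 * (f (x + (t + h) *: 'e_i) - f (x + t *: 'e_i))).
Proof.
move=> uf; have [G GP] := ucont_antiderivative i x uf.
rewrite (_ : (fun t => _) = fun t => h^-1 * (G (h + t) - G t)); last first.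
  by apply/funext => s; rewrite (avg_shift _ _ GP) (addrC s).
have G1 := antiderivative_shift h GP t; have G2 := GP t.
rewrite [t + h]addrC; apply: is_deriveZ; exact: is_deriveB.
Qed.

Let quarter_bound (a a' b b' c c' d d' e : R) :
  `|a - a'| <= e -> `|b - b'| <= e -> `|c - c'| <= e -> `|d - d'| <= e ->
  `|2^-1 * 2^-1 * (a + b + (c + d)) - 2^-1 * 2^-1 * (a' + c' + (b' + d'))| <= e.
Proof. rewrite !ler_norml; lra. Qed.

Let avg_comm_bound_double h i j f e : 0 < h -> ucont f ->
  (forall x, `|avg h i (avg h j f) x - avg h j (avg h i f) x| <= e) ->
  forall x, `|avg (2 * h) i (avg (2 * h) j f) x -
              avg (2 * h) j (avg (2 * h) i f) x| <= e.
Proof.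
move=> h0 uf fe x; have h20 : 0 < 2 * h by rewrite mulr_gt0.
(* An average of step 2h along two axes is the mean of four averages of step h, so the new defect is
   the mean of four old ones. *)
have E k l y : avg (2 * h) k (avg (2 * h) l f) y = 2^-1 * 2^-1 * (
     avg h k (avg h l f) y + avg h k (avg h l f) (y + h *: 'e_l)
     + (avg h k (avg h l f) (y + h *: 'e_k) +
       avg h k (avg h l f) (y + h *: 'e_k + h *: 'e_l))).
  rewrite avg_double; last exact: avg_ucont.
  have D z : avg h k (avg (2 * h) l f) z = 2^-1 * (
       avg h k (avg h l f) z + avg h k (avg h l f) (z + h *: 'e_l)).
    rewrite (_ : avg (2 * h) l f = fun z => 2^-1 * avg h l f z +
        2^-1 * avg h l f (z + h *: 'e_l)); last first.
      by apply/funext => u; rewrite avg_double// mulrDr.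
    rewrite avgD; [|exact: avg_ucont|by apply: ucont_trans; exact: avg_ucont].
    by rewrite avg_trans mulrDr.
  by rewrite !D -mulrDr mulrA.
rewrite !E (addrAC x (h *: 'e_j)); exact: quarter_bound.
Qed.

Let avg_near h i f x c e : 0 < h -> ucont f ->
  (forall t, 0 <= t <= h -> `|f (x + t *: 'e_i) - c| <= e) ->
  `|avg h i f x - c| <= e.
Proof. by move=> h0 uf fe; have [t th ->] := avg_MVT i x uf h0; exact: fe. Qed.

(* The defect of commutation is a contraction under doubling of the step, and
   tends to 0 with the step, as both iterated averages tend to f. *)
Lemma avg_comm h i j f : 0 < h -> ucont f ->
  avg h i (avg h j f) = avg h j (avg h i f).
Proof.
move=> h0 uf; apply/funext => x.
suff fe e : 0 < e -> forall x,
    `|avg h i (avg h j f) x - avg h j (avg h i f) x| <= e.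
  apply/eqP; rewrite -subr_eq0 -normr_le0; apply/ler_addgt0Pr => e e0.
  by rewrite add0r; exact: fe.
move=> {x}/[dup] e0 /(@divr_gt0 _ _ 2)-/(_ ltac:(done))/uf[d d0 fd].
(* Half of d, since for i = j both displacements fall on the same axis. *)
have [m hm] : exists m, h / 2 ^+ m < d / 2.
  have dh0 := divr_gt0 d0 (mulr_gt0 (ltr0Sn R 1) h0).
  have [m _ hm] := @near_infty_natSinv_expn_lt R (PosNum dh0).
  exists m; have := hm m (leqnn m) => /=.
  rewrite ltr_pdivlMr ?mulr_gt0// mul1r; move: (2 ^+ m)^-1 => z; lra.
rewrite -(mulfVK (_ : 2 ^+ m != 0) h) ?expf_neq0//.
have : 0 < h / 2 ^+ m by rewrite divr_gt0// exprn_gt0.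
move: (h / _) hm => k {h h0} kd k0; rewrite mulrC.
elim: m => [|m IHm] x; last first.
  rewrite exprS -mulrA; apply: avg_comm_bound_double => //.
  by rewrite mulr_gt0// exprn_gt0.
rewrite expr0 mul1r.
have near i' j' : `|avg k i' (avg k j' f) x - f x| <= e / 2.
  apply: avg_near => // [|t tk]; first exact: avg_ucont.
  apply: avg_near => // s sk; apply: fd => l; rewrite !rowD_delta.
  rewrite -(addrA (x ord0 l)) addrAC subrr add0r.
  move: tk sk => /andP[t0 tk] /andP[s0 sk].
  case: (l == i'); case: (l == j'); rewrite ?mulr1 ?mulr0;
    rewrite ger0_norm; lra.
move: (near i j) (near j i).
by move: (avg _ _ _ x) (avg _ _ _ x) (f x) => a b c; rewrite !ler_norml; lra.
Qed.

End averages.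

Section iterated_averages.
Context {R : realType} {n : nat}.
Local Notation Rn := 'rV[R]_n.
Implicit Types (f g : Rn -> R) (x y v : Rn) (i j k : 'I_n) (h t c e : R).
Implicit Types (s : seq 'I_n).

Definition avgs h s f : Rn -> R := foldr (avg h) f s.

Definition dif h i f x : R := f (x + h *: 'e_i) - f x.

Definition dbl h i f x : R := f x + f (x + h *: 'e_i).

(** For s without repetitions, the unnormalised sum of f over the corners obtained from x by adding
    h along a subset of the axes in s. Over all axes, F (2h) = dbls h F_h expresses additivity under
    bisection of cubes. *)
Definition dbls h s f : Rn -> R := foldr (dbl h) f s.

Lemma avgs_ucont h s f : 0 < h -> ucont f -> ucont (avgs h s f).
Proof. by move=> h0 uf; elim: s => //= i s IHs; exact: avg_ucont. Qed.

Lemma dif_ucont h i f : ucont f -> ucont (dif h i f).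
Proof.
move=> uf; rewrite (_ : dif h i f = fun x => 1 * f (x + h *: 'e_i) + -1 * f x).
  by apply: ucontD => //; exact: ucont_trans.
by apply/funext => x; rewrite mul1r mulN1r.
Qed.

Lemma dbl_ucont h i f : ucont f -> ucont (dbl h i f).
Proof.
move=> uf; rewrite (_ : dbl h i f = fun x => 1 * f x + 1 * f (x + h *: 'e_i)).
  by apply: ucontD => //; exact: ucont_trans.
by apply/funext => x; rewrite !mul1r.
Qed.

Lemma dbls_ucont h s f : ucont f -> ucont (dbls h s f).
Proof. by move=> uf; elim: s => //= i s IHs; exact: dbl_ucont. Qed.

Lemma avgs_rem h i s f : 0 < h -> ucont f -> i \in s ->
  avgs h s f = avg h i (avgs h (rem i s) f).
Proof.
move=> h0 uf; elim: s => //= j s IHs; rewrite inE eq_sym.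
have [-> //|ji /= /IHs ->] := eqVneq j i.
by rewrite avg_comm//; exact: avgs_ucont.
Qed.

Lemma avgs_perm h s s' f : 0 < h -> ucont f -> perm_eq s s' ->
  avgs h s f = avgs h s' f.
Proof.
move=> h0 uf; elim: s s' => [s'|i s IHs s' ss'].
  by rewrite perm_sym => /perm_nilP ->.
have is' : i \in s' by rewrite -(perm_mem ss') mem_head.
rewrite (avgs_rem h0 uf is') -(IHs (rem i s'))//.
by rewrite -(perm_cons i) (permPl ss') perm_to_rem.
Qed.

Lemma avgsD h s f g a b : 0 < h -> ucont f -> ucont g ->
  avgs h s (fun x => a * f x + b * g x) =
  fun x => a * avgs h s f x + b * avgs h s g x.
Proof.
move=> h0 uf ug; elim: s => //= i s ->; apply/funext => x.
by rewrite avgD//; exact: avgs_ucont.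
Qed.

Lemma avgs_trans h s f v :
  avgs h s (fun x => f (x + v)) = fun x => avgs h s f (x + v).
Proof.
by elim: s => //= i s ->; apply/funext => x; rewrite avg_trans.
Qed.

Lemma avgs_dif h s i f : 0 < h -> ucont f ->
  avgs h s (dif h i f) = dif h i (avgs h s f).
Proof.
move=> h0 uf; have ut := ucont_trans (h *: 'e_i) uf.
have /funext -> : dif h i f =1 fun x => 1 * f (x + h *: 'e_i) + -1 * f x.
  by move=> x; rewrite mul1r mulN1r.
by rewrite avgsD// avgs_trans; apply/funext => x; rewrite mul1r mulN1r.
Qed.

Lemma avg_dbl h k i f : 0 < h -> ucont f ->
  avg h k (dbl h i f) = dbl h i (avg h k f).
Proof.
move=> h0 uf; have ut := ucont_trans (h *: 'e_i) uf.
have /funext -> : dbl h i f =1 fun x => 1 * f x + 1 * f (x + h *: 'e_i).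
  by move=> x; rewrite !mul1r.
by apply/funext => x; rewrite avgD// avg_trans !mul1r.
Qed.

Lemma avg_dbls h k s f : 0 < h -> ucont f ->
  avg h k (dbls h s f) = dbls h s (avg h k f).
Proof.
move=> h0 uf; elim: s => //= i s <-.
by rewrite avg_dbl//; exact: dbls_ucont.
Qed.

Lemma dblsD h s f g a b : dbls h s (fun x => a * f x + b * g x) =
  fun x => a * dbls h s f x + b * dbls h s g x.
Proof.
by elim: s => //= i s ->; apply/funext => x; rewrite /dbl; ring.
Qed.

Lemma dblsZ h s f a : dbls h s (fun x => a * f x) = fun x => a * dbls h s f x.
Proof.
by elim: s => //= i s ->; apply/funext => x; rewrite /dbl mulrDr.
Qed.

Lemma dbls_sum h s (I : finType) (F : I -> Rn -> R) :
  dbls h s (fun x => \sum_i F i x) = fun x => \sum_i dbls h s (F i) x.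
Proof.
by elim: s => //= i s ->; apply/funext => x; rewrite /dbl -big_split.
Qed.

Lemma dblC h i j f : dbl h i (dbl h j f) = dbl h j (dbl h i f).
Proof.
by apply/funext => x; rewrite /dbl addrACA (addrAC x).
Qed.

Lemma dbls_rem h i s f : i \in s -> dbls h s f = dbl h i (dbls h (rem i s) f).
Proof.
elim: s => //= j s IHs; rewrite inE eq_sym.
by have [-> //|ji /= /IHs ->] := eqVneq j i; rewrite dblC.
Qed.

Lemma dbls_dif h i s f : dbls h s (dif h i f) = dif h i (dbls h s f).
Proof.
elim: s => //= j s ->; apply/funext => x; rewrite /dbl /dif (addrAC x); ring.
Qed.

Lemma avgs_double h s f : 0 < h -> ucont f ->
  avgs (2 * h) s f = fun x => 2^-1 ^+ size s * dbls h s (avgs h s f) x.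
Proof.
move=> h0 uf; elim: s => [|i s IHs] /=.
  by apply/funext => x; rewrite mul1r.
rewrite IHs; have us := avgs_ucont s h0 uf; apply/funext => x.
have ud := dbls_ucont h s us.
rewrite avg_double; last first.
  (* A scalar multiple is treated as a linear combination whose second coefficient is 0. *)
  have := ucontD (2^-1 ^+ size s) 0 ud ud; congr (ucont _).
  by apply/funext => y; rewrite mul0r addr0.
have E y : avg h i (fun x => 2^-1 ^+ size s * dbls h s (avgs h s f) x) y =
    2^-1 ^+ size s * dbls h s (avg h i (avgs h s f)) y.
  rewrite -avg_dbls//.
  rewrite (_ : (fun x => _) = fun x => 2^-1 ^+ size s * dbls h s (avgs h s f) x
     + 0 * dbls h s (avgs h s f) x).
    by rewrite avgD// mul0r addr0.
  by apply/funext => z; rewrite mul0r addr0.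
by rewrite !E -mulrDr mulrA -exprS.
Qed.

(** The mean value property, once per axis of s. Without repetitions no coordinate moves by more
    than h, and those outside s do not move at all. *)
Lemma avgs_bound h s f x c e : 0 < h -> ucont f -> uniq s ->
  (forall y : Rn,
    (forall k, x ord0 k <= y ord0 k <= x ord0 k + h * (k \in s)%:R) ->
    `|f y - c| <= e) ->
  `|avgs h s f x - c| <= e.
Proof.
move=> h0 uf; elim: s x => [|i s IHs] x /=.
  by move=> _; apply => k; rewrite mulr0 addr0 lexx.
move=> /andP[si us] fe.
have [t /andP[t0 th] ->] := avg_MVT i x (avgs_ucont s h0 uf) h0.
apply: IHs => // y xy; apply: fe => k; have := xy k.
rewrite rowD_delta inE; have [-> /=|_ /=] := eqVneq k i.
  by rewrite (negbTE si) !mulr1 mulr0; lra.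
by rewrite mulr0 addr0.
Qed.

(** Pigeonhole over the corners: a bound that fails for the sums fails for one summand. It selects
    the bad half-size cube in a bisection. *)
Lemma dbls_select h s f g x : 0 <= h -> uniq s ->
  dbls h s g x < `|dbls h s f x| ->
  exists2 y : Rn,
    (forall k, x ord0 k <= y ord0 k <= x ord0 k + h * (k \in s)%:R) &
    g y < `|f y|.
Proof.
move=> h0; elim: s x => [|i s IHs] x /=.
  by move=> _ gf; exists x => // k; rewrite mulr0 addr0 lexx.
move=> /andP[si us]; rewrite {1}/dbl => gf.
have [/IHs[]// y xy gfy|gf1] := ltP (dbls h s g x) `|dbls h s f x|.
  exists y => // k; have /andP[-> yk] := xy k; rewrite (le_trans yk)//.
  by rewrite lerD2l ler_wpM2l// ler_nat inE; case: (k \in s); rewrite ?orbT.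
have [/IHs[]// y xy gfy|gf2] :=
    ltP (dbls h s g (x + h *: 'e_i)) `|dbls h s f (x + h *: 'e_i)|.
  exists y => // k; have := xy k; rewrite rowD_delta inE.
  have [-> /=|_ /=] := eqVneq k i; last by rewrite mulr0 addr0.
  by rewrite (negbTE si) !mulr1 mulr0; lra.
have := le_trans (ler_normD _ _) (lerD gf1 gf2).
by rewrite leNgt gf.
Qed.

Let E := enum 'I_n.

(* h^(n-1) times facediff h j f x is the integral of f over the face
   y_j = x_j + h of the cube x + [0, h]^n minus that over the face y_j = x_j. *)
Definition facediff h j f : Rn -> R := dif h j (avgs h (rem j E) f).

Definition cubeavg h f : Rn -> R := avgs h E f.

Lemma facediff_ucont h j f : 0 < h -> ucont f -> ucont (facediff h j f).
Proof. by move=> h0 uf; apply/dif_ucont/avgs_ucont. Qed.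

Lemma facediffD h j f g a b : 0 < h -> ucont f -> ucont g ->
  facediff h j (fun x => a * f x + b * g x) =
  fun x => a * facediff h j f x + b * facediff h j g x.
Proof.
move=> h0 uf ug; rewrite /facediff avgsD//; apply/funext => x.
by rewrite /dif; ring.
Qed.

Lemma facediffZ h j f a : 0 < h -> ucont f ->
  facediff h j (fun x => a * f x) = fun x => a * facediff h j f x.
Proof.
move=> h0 uf; have := facediffD j a 0 h0 uf uf.
rewrite (_ : (fun x => a * f x + 0 * f x) = fun x => a * f x) => [->|].
  by apply/funext => x; rewrite mul0r addr0.
by apply/funext => x; rewrite mul0r addr0.
Qed.

Lemma avgs_comm h s s' f : 0 < h -> ucont f ->
  avgs h s (avgs h s' f) = avgs h s' (avgs h s f).
Proof.
move=> h0 uf; rewrite /avgs -!foldr_cat.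
by apply: avgs_perm => //; rewrite perm_catC.
Qed.

Lemma facediffC h i j f : 0 < h -> ucont f ->
  facediff h i (facediff h j f) = facediff h j (facediff h i f).
Proof.
move=> h0 uf; rewrite /facediff !avgs_dif//; last 2 first.
- exact: avgs_ucont.
- exact: avgs_ucont.
rewrite (avgs_comm (rem i E))//; apply/funext => x; rewrite /dif (addrAC x); ring.
Qed.

Lemma size_rem_enum j : size (rem j E) = n.-1.
Proof. by rewrite size_rem ?mem_enum// size_enum_ord. Qed.

(** Along axis j the sum telescopes, since the face shared by two adjacent half-size cubes cancels;
    the other n-1 axes contribute the normalising factor. *)
Lemma facediff_double h j f : 0 < h -> ucont f ->
  facediff (2 * h) j f = fun x => 2^-1 ^+ n.-1 * dbls h E (facediff h j f) x.
Proof.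
move=> h0 uf; rewrite /facediff avgs_double// size_rem_enum.
apply/funext => x; rewrite (@dbls_rem h j E) ?mem_enum// dbls_dif.
rewrite /dbl /dif mulr_natl mulr2n scalerDl addrA.
by rewrite -mulrBr; congr (_ * _); rewrite [RHS]addrC addrA subrK.
Qed.

Lemma cubeavg_avg h j f : 0 < h -> ucont f ->
  cubeavg h f = avg h j (avgs h (rem j E) f).
Proof. by move=> h0 uf; rewrite /cubeavg (@avgs_rem _ j)// mem_enum. Qed.

Lemma cubeavg_ucont h f : 0 < h -> ucont f -> ucont (cubeavg h f).
Proof. exact: avgs_ucont. Qed.

(** Commutation brings the average along axis j to the outside, where its derivative is a difference
    quotient of the remaining averages. *)
Lemma cubeavg_derive h j f x t : 0 < h -> ucont f ->
  is_derive t (1 : R) (fun t => cubeavg h f (x + t *: 'e_j))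
    (h^-1 * facediff h j f (x + t *: 'e_j)).
Proof.
move=> h0 uf; rewrite (cubeavg_avg j)//.
have := avg_derive h j x t (avgs_ucont (rem j E) h0 uf).
by rewrite scalerDl addrA.
Qed.

Lemma facediff_cubeavg h j f : 0 < h -> ucont f ->
  facediff h j (cubeavg h f) = cubeavg h (facediff h j f).
Proof.
move=> h0 uf; rewrite /facediff /cubeavg avgs_dif//; last exact: avgs_ucont.
by rewrite avgs_comm.
Qed.

Lemma cubeavg_derive2 h j f x t : 0 < h -> ucont f ->
  is_derive t (1 : R)
    (fun t => h^-1 * facediff h j (cubeavg h f) (x + t *: 'e_j))
    (h^-1 * (h^-1 * facediff h j (facediff h j f) (x + t *: 'e_j))).
Proof.
move=> h0 uf; rewrite facediff_cubeavg//; apply: is_deriveZ.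
by apply: cubeavg_derive => //; exact: facediff_ucont.
Qed.

Lemma cubeavg_bound h f x c e : 0 < h -> ucont f ->
  (forall y : Rn, (forall k, x ord0 k <= y ord0 k <= x ord0 k + h) ->
    `|f y - c| <= e) ->
  `|cubeavg h f x - c| <= e.
Proof.
move=> h0 uf fe; apply: avgs_bound => // [|y xy]; first exact: enum_uniq.
by apply: fe => k; have := xy k; rewrite mem_enum mulr1.
Qed.

(** A face difference is the average, over the lower face y_j = x_j, of the increments of f across
    the cube. *)
Lemma facediff_bound h j f x c e : 0 < h -> ucont f ->
  (forall y : Rn, (forall k, x ord0 k <= y ord0 k <= x ord0 k + h) ->
    y ord0 j = x ord0 j -> `|f (y + h *: 'e_j) - f y - c| <= e) ->
  `|facediff h j f x - c| <= e.
Proof.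
move=> h0 uf fe; rewrite /facediff -avgs_dif//.
have uE := enum_uniq 'I_n.
apply: avgs_bound => // [||y xy]; [exact: dif_ucont|exact: rem_uniq|].
apply: fe => [k|].
  have /andP[-> yk] := xy k; rewrite (le_trans yk)// lerD2l ler_piMr ?(ltW h0)//.
  by rewrite lern1 leq_b1.
have := xy j; rewrite mem_rem_uniq// inE eqxx mulr0 addr0.
by move=> /andP[? ?]; apply/eqP; rewrite eq_le; apply/andP.
Qed.

End iterated_averages.

(** * Flux through cubes *)

Section bisection.
Context {R : realType} {n : nat}.
Local Notation Rn := 'rV[R]_n.
Let E := enum 'I_n.

Lemma half_expn_lt (h d : R) : 0 < d -> exists m, h / 2 ^+ m < d.
Proof.
move=> d0; have [h0|h0] := leP h 0.
  by exists 0%N; rewrite expr0 divr1 (le_lt_trans h0).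
have [m _ hm] := @near_infty_natSinv_expn_lt R (PosNum (divr_gt0 d0 h0)).
by exists m; have := hm m (leqnn m); rewrite /= ltr_pdivlMr// mul1r mulrC.
Qed.

(** Take the least m with h / 2^m <= d. The upper bound is the assumption d < 2h for m = 0 and
    minimality otherwise. *)
Lemma half_expn_between (h d : R) : 0 < h -> 0 < d < 2 * h ->
  exists m, h / 2 ^+ m <= d < 2 * (h / 2 ^+ m).
Proof.
move=> h0 /andP[d0 dh]; have hm : exists m, h / 2 ^+ m <= d.
  by have [m /ltW] := half_expn_lt h d0; exists m.
exists (ex_minn hm); case: ex_minnP => -[|m] -> /= hmin.
  by rewrite expr0 divr1.
rewrite exprS invfM mulrCA mulVKf// ltNge.
by apply/negP => /hmin; rewrite ltnn.
Qed.

(* Cousin's lemma: halving the cubes on which the bound fails produces nested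
   cubes shrinking to a point z, where it holds at some scale. *)
Lemma cube_bisection (F T : R -> Rn -> R) (h : R) (a : Rn) : 0 < h ->
  (forall h, 0 < h -> F (2 * h) = dbls h E (F h)) ->
  (forall h, 0 < h -> T (2 * h) = dbls h E (T h)) ->
  (forall z : Rn, exists m, forall x : Rn,
    (forall k, x ord0 k <= z ord0 k <= x ord0 k + h / 2 ^+ m) ->
    `|F (h / 2 ^+ m) x| <= T (h / 2 ^+ m) x) ->
  `|F h a| <= T h a.
Proof.
move=> h0 F2 T2 loc; rewrite leNgt; apply/negP => Fa.
pose d m := h / 2 ^+ m.
have d0 m : 0 < d m by rewrite divr_gt0// exprn_gt0.
have d2 m : d m = 2 * d m.+1.
  by rewrite /d exprS invfM mulrCA mulVKf.
pose bad m x := T (d m) x < `|F (d m) x|.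
have step (p : nat * Rn) : exists y : Rn, bad p.1 p.2 ->
    (forall k, p.2 ord0 k <= y ord0 k <= p.2 ord0 k + d p.1.+1) /\ bad p.1.+1 y.
  have [bp|nbp] := pselect (bad p.1 p.2); last by exists 0.
  move: (bp); rewrite /bad d2 F2// T2// => /dbls_select[||y py by_].
  - exact/ltW/d0.
  - exact: enum_uniq.
  - exists y => _; split=> // k; have := py k.
    by rewrite mem_enum mulr1.
have [g gP] := choice step.
pose x := nat_rect (fun=> Rn) a (fun m y => g (m, y)).
have xbad m : bad m (x m).
  elim: m => [|m IHm]; first by rewrite /bad /d expr0 divr1.
  by have [] := gP (m, x m) IHm.
have xS m k : x m ord0 k <= x m.+1 ord0 k <= x m ord0 k + d m.+1.
  by have [+ _] := gP (m, x m) (xbad m); apply.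
have xadd m p k : x m ord0 k <= x (m + p)%N ord0 k /\
    x (m + p)%N ord0 k + d (m + p)%N <= x m ord0 k + d m.
  elim: p => [|p [IH1 IH2]]; first by rewrite addn0.
  have /andP[le1 le2] := xS (m + p)%N k; rewrite addnS; split.
    exact: le_trans le1.
  by have := d2 (m + p)%N; lra.
have xub m p k : x p ord0 k <= x m ord0 k + d m.
  have [mp|/ltnW pm] := leqP m p.
    have [_] := xadd m (p - m)%N k; rewrite subnKC//.
    by have := d0 p; lra.
  have [+ _] := xadd p (m - p)%N k; rewrite subnKC//.
  by have := d0 m; lra.
(* By [xub] every lower corner stays below every upper corner, so the coordinatewise supremum of the
   lower corners lies in all the cubes. *)
pose X k := [set x m ord0 k | m in [set: nat]].
pose z : Rn := \row_k sup (X k).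
have zP m k : x m ord0 k <= z ord0 k <= x m ord0 k + d m.
  rewrite mxE; apply/andP; split.
    apply: ub_le_sup; last by exists m.
    by exists (x m ord0 k + d m) => _ [p _ <-].
  apply: ge_sup; first by exists (x m ord0 k), m.
  by move=> _ [p _ <-].
have [m /(_ (x m) (zP m)) Fx] := loc z.
by have := lt_le_trans (xbad m) Fx; rewrite ltxx.
Qed.

(** For nondecreasing l i, the measure of the cube x + [0, h]^n under the product of the measures
    with distribution functions l i. Identities give the volume, clamps the volume of the part
    inside a box. *)
Definition boxprod (l : 'I_n -> R -> R) (h : R) (x : Rn) : R :=
  \prod_i (l i (x ord0 i + h) - l i (x ord0 i)).

Lemma boxprod_double l h : boxprod l (2 * h) = dbls h E (boxprod l h).
Proof.
(* Axes in s have their side already doubled; adding an axis k telescopes the two increments of l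
   k. *)
suff H s x : uniq s -> dbls h s (boxprod l h) x = \prod_i
    (l i (x ord0 i + (if i \in s then 2 * h else h)) - l i (x ord0 i)).
  apply/funext => x; rewrite H ?enum_uniq//; apply: eq_bigr => i _.
  by rewrite mem_enum.
elim: s x => [|k s IHs] x //= /andP[ks us].
rewrite /dbl !IHs// [X in X + _](bigD1 k)//= [X in _ + X](bigD1 k)//=.
rewrite [RHS](bigD1 k)//= (negbTE ks) mem_head rowD_delta eqxx mulr1.
have -> : \prod_(i < n | i != k)
    (l i ((x + h *: 'e_k) ord0 i + (if i \in s then 2 * h else h)) -
     l i ((x + h *: 'e_k) ord0 i)) =
  \prod_(i < n | i != k)
    (l i (x ord0 i + (if i \in s then 2 * h else h)) - l i (x ord0 i)).
  by apply: eq_bigr => i /negbTE ik; rewrite rowD_delta ik mulr0 addr0.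
rewrite -mulrDl; congr (_ * _).
  have -> : x ord0 k + 2 * h = x ord0 k + h + h by ring.
  by rewrite addrC addrA subrK.
apply: eq_bigr => i /negbTE ik.
by rewrite inE ik.
Qed.

End bisection.

Section flux.
Context {R : realType} {n : nat}.
Local Notation Rn := 'rV[R]_n.
Implicit Types (v : 'I_n -> Rn -> R).
Let E := enum 'I_n.

(* The flux of v out of the cube a + [0, h]^n, see facediff. *)
Definition flux v (h : R) (a : Rn) : R :=
  h ^+ n.-1 * \sum_j facediff h j (v j) a.

Lemma flux_double v h : 0 < h -> (forall j, ucont (v j)) ->
  flux v (2 * h) = dbls h E (flux v h).
Proof.
move=> h0 uv; rewrite /flux dblsZ dbls_sum; apply/funext => x.
under eq_bigr => j _ do rewrite facediff_double//.
by rewrite -mulr_sumr exprMn mulrACA -exprMn mulfV// expr1n mul1r.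
Qed.

(** For d >= 0, the projection onto [b - d, b + d]: its increment from s to t is the length of the
    part of [s, t] in that interval. *)
Definition clamp (b d t : R) : R := Num.max (b - d) (Num.min (b + d) t).

Lemma clamp_id b d t : b - d <= t <= b + d -> clamp b d t = t.
Proof. by move=> /andP[? ?]; rewrite /clamp min_r// max_r. Qed.

Lemma clamp_sub b d s t : 0 <= d -> s <= t ->
  0 <= clamp b d t - clamp b d s <= 2 * d.
Proof.
move=> d0 st.
have cl u : [\/ u <= b - d /\ clamp b d u = b - d,
    b - d <= u <= b + d /\ clamp b d u = u |
    b + d <= u /\ clamp b d u = b + d].
  have [u1|/ltW u1] := leP u (b - d).
    by constructor 1; rewrite /clamp min_r ?max_l//; lra.
  have [u2|/ltW u2] := leP u (b + d).
    by constructor 2; rewrite clamp_id u1.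
  by constructor 3; rewrite /clamp min_l// max_r//; lra.
by case: (cl t) => -[? ->]; case: (cl s) => -[? ->]; lra.
Qed.

Variables (S : set Rn) (M mu : R) (v dv : 'I_n -> Rn -> R).
Hypothesis uv : forall j, ucont (v j).
Hypothesis mu_ge0 : 0 <= mu.
Hypothesis M_ge0 : 0 <= M.
Hypothesis n_gt0 : (0 < n)%N.
Hypothesis hold : forall j (x : Rn) (h : R), 0 < h ->
  `|v j (x + h *: 'e_j) - v j x| <= M * h `^ mu.
Hypothesis openS : forall x : Rn, ~ S x -> exists2 d : R, 0 < d &
  forall y : Rn, (forall i, `|y ord0 i - x ord0 i| < d) -> ~ S y.
Hypothesis dvP : forall j (x : Rn) (t : R), ~ S (x + t *: 'e_j) ->
  is_derive t (1 : R) (fun t => v j (x + t *: 'e_j)) (dv j (x + t *: 'e_j)).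
Hypothesis dvC : forall x : Rn, ~ S x -> forall e : R, 0 < e ->
  exists2 d : R, 0 < d & forall (y : Rn) j,
    (forall i, `|y ord0 i - x ord0 i| < d) -> `|dv j y - dv j x| <= e.
Hypothesis div0 : forall x, ~ S x -> \sum_j dv j x = 0.
Hypothesis cover : forall e d : R, 0 < e -> 0 < d ->
  exists N (c : 'I_N -> Rn) (r : 'I_N -> R),
  [/\ forall k, 0 < r k < d,
      forall x, S x -> exists k, forall i, `|x ord0 i - c k ord0 i| < r k &
   \sum_k r k `^ (n.-1%:R + mu) <= e].

(** By the mean value theorem each increment across the cube is h times a value of dv j near z, so
    each face difference is h * dv j z up to h * e / n; the main terms add up to 0 by [div0]. *)
Lemma flux_off_S (z : Rn) (e : R) : ~ S z -> 0 < e -> exists2 d : R, 0 < d &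
  forall (h : R) (x : Rn), 0 < h < d ->
  (forall k, x ord0 k <= z ord0 k <= x ord0 k + h) ->
  `|flux v h x| <= e * h ^+ n.
Proof.
move=> Sz e0; pose e1 := e / n%:R.
have n0 : 0 < n%:R :> R by rewrite ltr0n.
have [d1 d10 Sd] := openS Sz.
have [|d2 d20 dvd] := dvC Sz (e := e1); first exact: divr_gt0.
exists (Num.min d1 d2) => [|h x /andP[h0]]; first by rewrite lt_min d10.
rewrite lt_min => /andP[hd1 hd2] xz.
have fj j : `|facediff h j (v j) x - h * dv j z| <= h * e1.
  apply: facediff_bound => // y xy yj.
  have near t : 0 <= t <= h -> forall i,
      `|(y + t *: 'e_j) ord0 i - z ord0 i| <= h.
    move=> th i; have := xy i; have := xz i; rewrite rowD_delta ler_norml.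
    case: eqVneq => [->|_]; first by rewrite yj mulr1; lra.
    by rewrite mulr0; lra.
  have dvt t : 0 <= t <= h ->
      is_derive t (1 : R) (fun t => v j (y + t *: 'e_j)) (dv j (y + t *: 'e_j)).
    by move=> th; apply/dvP/Sd => i; apply: le_lt_trans (near t th i) _.
  have dvt' t : t \in `]0, h[ ->
      is_derive t (1 : R) (fun t => v j (y + t *: 'e_j)) (dv j (y + t *: 'e_j)).
    by rewrite in_itv/= => /andP[/ltW t0 /ltW th]; apply: dvt; rewrite t0.
  have cv : {within `[0, h], continuous (fun t => v j (y + t *: 'e_j))}.
    by apply: continuous_subspaceT; exact: ucont_line.
  have [t] := MVT_segment (ltW h0) dvt' cv.
  rewrite in_itv/= scale0r addr0 subr0 => th ->.
  rewrite mulrC -mulrBr normrM gtr0_norm// ler_wpM2l ?(ltW h0)//.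
  by apply: dvd => i; apply: le_lt_trans (near t th i) _.
have -> : flux v h x = h ^+ n.-1 * \sum_j (facediff h j (v j) x - h * dv j z).
  by rewrite sumrB -mulr_sumr div0// mulr0 subr0.
rewrite normrM (gtr0_norm (exprn_gt0 _ h0)).
apply: (@le_trans _ _ (h ^+ n.-1 * (n%:R * (h * e1)))).
  rewrite ler_wpM2l ?exprn_ge0 ?(ltW h0)// (le_trans (ler_norm_sum _ _ _))//.
  rewrite (le_trans (ler_sum _ (fun j _ => fj j)))//.
  by rewrite sumr_const card_ord mulr_natl.
rewrite /e1 mulrCA [n%:R * _]mulrC -!mulrA mulVf ?gt_eqF// mulr1.
by rewrite mulrA -exprSr prednK// mulrC.
Qed.

Lemma flux_hoelder h x : 0 < h ->
  `|flux v h x| <= n%:R * M * (h ^+ n.-1 * h `^ mu).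
Proof.
move=> h0; rewrite normrM (gtr0_norm (exprn_gt0 _ h0)) mulrCA.
rewrite ler_wpM2l ?exprn_ge0 ?(ltW h0)// (le_trans (ler_norm_sum _ _ _))//.
have fj j : `|facediff h j (v j) x| <= M * h `^ mu.
  rewrite -[X in `|X|]subr0; apply: facediff_bound => // y _ _.
  by rewrite subr0; exact: hold.
rewrite (le_trans (ler_sum _ (fun j _ => fj j)))// sumr_const card_ord.
by rewrite -mulrA mulr_natl.
Qed.

Lemma flux_eq0 h a : 0 < h -> flux v h a = 0.
Proof.
move=> h0; apply/eqP; rewrite -normr_le0; apply/ler_addgt0Pr => A A0.
rewrite add0r; have hn : 0 < h ^+ n by rewrite exprn_gt0.
(* The factor n M comes from [flux_hoelder]; 2^n compensates (d / r k)^n for a cube side d with r k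
   < 2 d. *)
pose C := 2 ^+ n * (n%:R * M).
have C0 : 0 <= C by rewrite mulr_ge0 ?exprn_ge0// mulr_ge0.
(* Half of the error A is spread evenly over the volume of the cube. *)
pose eta := A / 2 / h ^+ n.
have eta0 : 0 < eta by rewrite !divr_gt0.
(* The terms of all balls together are at most C 4^n times the covering sum, which is taken at most
   A / 2 / D; the 1 keeps D positive. Radii below 2h are what [half_expn_between] asks for. *)
pose D := C * 4 ^+ n + 1.
have D0 : 0 < D by rewrite ltr_wpDl// mulr_ge0// exprn_ge0.
have [N [c [r [r0 rS rsum]]]] :=
  cover (divr_gt0 (divr_gt0 A0 (ltr0Sn _ 1)) D0) (mulr_gt0 (ltr0Sn R 1) h0).
pose w k := C * (r k `^ (n.-1%:R + mu) / r k ^+ n).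
have w0 k : 0 <= w k.
  have /andP[rk0 _] := r0 k.
  by rewrite mulr_ge0// divr_ge0 ?powR_ge0// exprn_ge0// ltW.
(* Half-side 2 r k: a cube of side at most r k through a point of the k-th ball lies entirely in
   this box, so there B k is its full volume. *)
pose B k := boxprod (fun i => clamp (c k ord0 i) (2 * r k)).
have B0 k (d : R) (x : Rn) : 0 < d -> 0 <= B k d x <= (4 * r k) ^+ n.
  move=> d0; have /andP[rk0 _] := r0 k.
  have cl i : 0 <= clamp (c k ord0 i) (2 * r k) (x ord0 i + d) -
      clamp (c k ord0 i) (2 * r k) (x ord0 i) <= 4 * r k.
    have -> : 4 * r k = 2 * (2 * r k) by ring.
    by apply: clamp_sub; lra.
  rewrite prodr_ge0 => [/=|i _]; last by have /andP[] := cl i.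
  rewrite -[X in _ ^+ X]card_ord -prodr_const; apply: ler_prod => i _.
  exact: cl.
(* T is additive under bisection and bounds the flux at some scale near every
   point: its first term does so off S and, at the scale d with d <= r k < 2 * d,
   the k-th term of its sum does so in the k-th ball. *)
pose T (d : R) (x : Rn) :=
  eta * boxprod (fun _ t => t) d x + \sum_k w k * B k d x.
have volE (d : R) (x : Rn) : boxprod (fun _ t => t) d x = d ^+ n.
  rewrite /boxprod; under eq_bigr do rewrite addrC addKr.
  by rewrite prodr_const card_ord.
have F2 d : 0 < d -> flux v (2 * d) = dbls d E (flux v d).
  by move=> d0; exact: flux_double.
have T2 d : 0 < d -> T (2 * d) = dbls d E (T d).
  move=> d0; have -> : T d = fun x => eta * boxprod (fun _ t => t) d x +
      1 * \sum_k w k * B k d x.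
    by apply/funext => x; rewrite mul1r.
  rewrite dblsD dbls_sum; apply/funext => x; rewrite /T mul1r boxprod_double.
  congr (_ + _); apply: eq_bigr => k _.
  by rewrite dblsZ /B boxprod_double.
have Tge (d : R) (x : Rn) : 0 < d -> eta * d ^+ n <= T d x.
  move=> d0; rewrite /T volE lerDl sumr_ge0// => k _.
  by rewrite mulr_ge0//; have /andP[] := B0 k d x d0.
apply: (@le_trans _ _ (T h a)); last first.
  rewrite /T volE /eta divfK ?gt_eqF//.
  have -> : A = A / 2 + A / 2 by lra.
  rewrite {1}(_ : (A / 2 + A / 2) / 2 = A / 2); last by lra.
  rewrite lerD2l; apply: (@le_trans _ _
    (\sum_k C * 4 ^+ n * r k `^ (n.-1%:R + mu))).
    apply: ler_sum => k _; have /andP[rk0 _] := r0 k.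
    have /andP[_ Bk] := B0 k h a h0.
    apply: (le_trans (ler_wpM2l (w0 k) Bk)); rewrite /w exprMn.
    have := gt_eqF (exprn_gt0 n rk0); move: (r k ^+ n) (_ `^ _) => q p /negbT q0.
    by rewrite le_eqVlt; apply/orP; left; apply/eqP; field.
  rewrite -mulr_sumr; apply: (le_trans (ler_wpM2l _ rsum)).
    by rewrite mulr_ge0// exprn_ge0.
  rewrite mulrCA -[leRHS]mulr1 ler_wpM2l ?divr_ge0 ?(ltW A0)//.
  by rewrite ler_pdivrMr// mul1r /D lerDl.
apply: (@cube_bisection R n (flux v) T h a h0 F2 T2) => z.
have d0 m : 0 < h / 2 ^+ m by rewrite divr_gt0// exprn_gt0.
have [Sz|Sz] := pselect (S z); last first.
  have [d dd0 fd] := flux_off_S Sz eta0.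
  have [m hm] := half_expn_lt h dd0; exists m => x xz.
  by apply: le_trans (Tge _ x (d0 m)); apply: fd => //; rewrite d0 hm.
have [k rk] := rS z Sz; have [m hm] := half_expn_between h0 (r0 k).
exists m => x xz; move: (d0 m) hm xz; move: (h / _) => d {}d0 /andP[dr rd] xz.
have /andP[rk0 _] := r0 k.
apply: (le_trans (flux_hoelder x d0)).
apply: (@le_trans _ _ (w k * B k d x)); last first.
  rewrite /T volE (bigD1 k)//= addrCA lerDl addr_ge0//.
    by rewrite mulr_ge0 ?(ltW eta0)// exprn_ge0// ltW.
  by rewrite sumr_ge0// => l _; rewrite mulr_ge0//; have /andP[] := B0 l d x d0.
have -> : B k d x = d ^+ n.
  rewrite /B /boxprod -[X in _ ^+ X]card_ord -prodr_const.
  apply: eq_bigr => i _; have := rk i; rewrite ltr_norml => rki.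
  by have := xz i => xzi; rewrite !clamp_id; [rewrite addrC addKr|lra|lra].
rewrite /w /C -[X in _ <= X]mulrA.
rewrite -(powR_mulrn n.-1 (ltW d0)) -powRD; last by rewrite (gt_eqF d0) implybT.
apply: (@le_trans _ _ (n%:R * M * r k `^ (n.-1%:R + mu))).
  rewrite ler_wpM2l ?mulr_ge0//.
  by apply: ge0_ler_powR; rewrite ?nnegrE ?addr_ge0// ltW.
set p := r k `^ _; have p0 : 0 <= p by rewrite powR_ge0.
have -> : 2 ^+ n * (n%:R * M) * (p / r k ^+ n * d ^+ n) =
  n%:R * M * (p * (2 * d / r k) ^+ n).
  rewrite expr_div_n exprMn; ring.
rewrite ler_wpM2l ?mulr_ge0// ler_peMr// exprn_ege1//.
by rewrite ler_pdivlMr// mul1r ltW.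
Qed.

End flux.

(** * Decaying solutions of the Laplace equation *)

Section maximum_principle.
Context {R : realType} {n : nat}.
Local Notation Rn := 'rV[R]_n.

(** At the maximum f' vanishes; if c > 0, then f' is positive just to the right of 0 and f would
    exceed f 0 there. *)
Lemma derive2_at_max (f f' : R -> R) (c : R) :
  (forall t, is_derive t (1 : R) f (f' t)) -> is_derive 0 (1 : R) f' c ->
  (forall t, t \in `]-1, 1[%R -> f t <= f 0) -> c <= 0.
Proof.
move=> ff' f'c fmax; rewrite leNgt; apply/negP => c0.
have f'0 : f' 0 = 0.
  have in0 : (0 : R) \in `]-1, 1[%R by rewrite in_itv/= ltrN10 ltr01.
  have N11 : (-1 : R) <= 1 by lra.
  have fd t : t \in `]-1, 1[%R -> derivable f t 1 by move=> _; apply: ex_derive.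
  have [_ fE] := derive1_at_max N11 fd in0 fmax.
  by have [_ <-] := ff' 0.
have : h^-1 *: (f' (h *: 1 + 0) - f' 0) @[h --> 0^'] --> c.
  by have [dv <-] := f'c; exact: dv.
move/cvgr_gt => /(_ _ c0) [d /= d0 fd].
pose e := Num.min (d / 2) (1 / 2).
have e0 : 0 < e by rewrite lt_min !divr_gt0.
have [ed e1] : e < d /\ e < 1.
  by rewrite /e; split; rewrite gt_min; apply/orP; [left|right]; lra.
have fpos t : 0 < t -> t < d -> 0 < f' t.
  move=> t0 td; have := fd t; rewrite /ball_/= sub0r normrN gtr0_norm//.
  rewrite f'0 subr0 addr0 /GRing.scale/= mulr1 pmulr_rgt0 ?invr_gt0//.
  by apply=> //; rewrite gt_eqF.
have ff'' t : t \in `]0, e[%R -> is_derive t (1 : R) f (f' t) by [].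
have cf : {within `[0, e], continuous f}.
  by apply: derivable_within_continuous => t _; apply: ex_derive.
have [t] := MVT e0 ff'' cf; rewrite in_itv/= => /andP[t0 te].
have := fmax e; rewrite in_itv/= e1 (lt_trans _ e0)//= => /(_ isT) fe.
rewrite subr0 => fE; have : 0 < f' t * e.
  by rewrite mulr_gt0// fpos// (lt_trans te).
by rewrite -fE subr_gt0 ltNge fe.
Qed.

Lemma near_coords (x : Rn) (d : R) : 0 < d ->
  \forall y \near (x : Rn), forall i, `|x ord0 i - (y : Rn) ord0 i| < d.
Proof.
move=> d0; apply/nbhs_ballP; exists d => // y [_ xy] i.
exact: xy.
Qed.

Lemma coords_near (x : Rn) (A : set Rn) : nbhs x A -> exists2 d : R, 0 < d &
  forall y : Rn, (forall i, `|x ord0 i - y ord0 i| < d) -> A y.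
Proof.
move=> /nbhs_ballP[d d0 xA]; exists d => // y xy; apply: xA; split=> // i j.
by rewrite ord1; exact: xy.
Qed.

Lemma ucont_continuous (f : Rn -> R) : ucont f -> continuous f.
Proof.
move=> uf x; apply/(@cvgrPdist_le _ _ _ _ (nbhs_filter x)) => e /uf[d d0 fd].
by apply: filterS (near_coords x d0) => y xy; exact: fd.
Qed.

Definition vanishes_at_infinity (f : Rn -> R) := forall e : R, 0 < e ->
  exists r : R, forall x : Rn, (exists i, r < `|x ord0 i|) -> `|f x| <= e.

Lemma compact_cube (r : R) : compact [set x : Rn | forall i, `|x ord0 i| <= r].
Proof.
rewrite (_ : mkset _ = [set x : Rn | forall i, `[- r, r]%classic (x ord0 i)]).
  apply: (@rV_compact _ _ (fun=> `[- r, r]%classic)) => i.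
  exact: segment_compact.
by apply/seteqP; split=> x xr i; have := xr i; rewrite /= in_itv/= ler_norml.
Qed.

(** A vanishing Laplacian does not contradict the second derivative test, so a small multiple e of
    the squared norm is added, which makes the Laplacian 2 n e > 0. *)
Lemma harmonic_decay_le0 (U : Rn -> R) (d1 d2 : 'I_n -> Rn -> R) : (0 < n)%N ->
  continuous U ->
  vanishes_at_infinity U ->
  (forall j x t,
    is_derive t (1 : R) (fun t => U (x + t *: 'e_j)) (d1 j (x + t *: 'e_j))) ->
  (forall j x t,
    is_derive t (1 : R) (fun t => d1 j (x + t *: 'e_j)) (d2 j (x + t *: 'e_j))) ->
  (forall x, \sum_j d2 j x = 0) -> forall x, U x <= 0.
Proof.
move=> n0 cU decay U1 U2 lap x0; rewrite leNgt; apply/negP => m0.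
set m := U x0 in m0; have [r0 Ur0] := decay (m / 2) (divr_gt0 m0 (ltr0Sn _ 1)).
pose r := Num.max r0 0.
have r_ge0 : 0 <= r by rewrite le_max lexx orbT.
have Ur (x : Rn) : (exists i, r < `|x ord0 i|) -> `|U x| <= m / 2.
  move=> [i ri]; apply: Ur0; exists i; apply: le_lt_trans ri.
  by rewrite le_max lexx.
have nn0 : 0 < n%:R :> R by rewrite ltr0n.
(* This bounds the squared norm on the cube Q of half-side r + 1, so the perturbation is at most m /
   4 there. Where |U| <= m / 2 then V < m, so the maximum lies within r, with margin 1 for the
   interval of [derive2_at_max]. *)
pose b := n%:R * (r + 1) ^+ 2.
have b0 : 0 < b by rewrite mulr_gt0// exprn_gt0//; lra.
pose e := m / 4 / b.
have e0 : 0 < e by rewrite !divr_gt0.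
pose V (x : Rn) := U x + e * \sum_i x ord0 i ^+ 2.
have VU x : U x <= V x.
  by rewrite lerDl mulr_ge0 ?(ltW e0)// sumr_ge0// => i _; exact: sqr_ge0.
pose Q := [set x : Rn | forall i, `|x ord0 i| <= r + 1].
have cQ : compact Q by exact: compact_cube.
have cV : continuous V.
  have cs : continuous (fun x : Rn => \sum_i x ord0 i ^+ 2).
    apply: continuous_big => [|i _ x]; first exact: add_continuous.
    exact: (@continuous_comp _ _ _ (fun y : Rn => y ord0 i) (fun t : R => t ^+ 2)
      x (@coord_continuous _ _ _ _ _ x) (@exprn_continuous _ 2 _)).
  have -> : V = U + (cst e \* (fun x : Rn => \sum_i x ord0 i ^+ 2)) by [].
  move=> x; apply: continuousD; first exact: cU.
  by apply: continuousM; [exact: cst_continuous|exact: cs].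
have x0r i : `|x0 ord0 i| <= r.
  rewrite leNgt; apply/negP => ri; have : `|U x0| <= m / 2 by apply: Ur; exists i.
  by rewrite ger0_norm -/m; lra.
have [|p] := EVT_max_rV _ cQ (continuous_subspaceT cV).
  by exists x0 => i; rewrite (le_trans (x0r i))// lerDl.
rewrite inE => Qp pmax.
have Vp : m <= V p.
  apply: le_trans (VU x0) (pmax _ _); rewrite inE => i.
  by rewrite (le_trans (x0r i))// lerDl.
have pr i : `|p ord0 i| <= r.
  rewrite leNgt; apply/negP => ri; have : `|U p| <= m / 2 by apply: Ur; exists i.
  rewrite ler_norml => /andP[_ Up].
  have : \sum_i p ord0 i ^+ 2 <= b.
    rewrite /b -[X in X%:R]card_ord mulr_natl -sumr_const; apply: ler_sum => j _.
    rewrite -[p ord0 j ^+ 2]real_normK ?num_real//.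
    by apply: lerXn2r; rewrite ?nnegrE ?Qp//; lra.
  rewrite -(ler_pM2l e0) /e [X in _ <= X](divfK (lt0r_neq0 b0)) -/e => eb.
  by move: Vp; rewrite /V; lra.
have d2p j : d2 j p + 2 * e <= 0.
  pose q t := \sum_i (p + t *: 'e_j) ord0 i ^+ 2.
  have qE t : q t = \sum_i p ord0 i ^+ 2 + (2 * p ord0 j * t + t ^+ 2).
    rewrite /q (bigD1 j)//= [in RHS](bigD1 j)//= rowD_delta eqxx mulr1.
    rewrite (eq_bigr (fun i => p ord0 i ^+ 2)); first by ring.
    by move=> i /negbTE ij; rewrite rowD_delta ij mulr0 addr0.
  pose f t := V (p + t *: 'e_j).
  pose f' t := d1 j (p + t *: 'e_j) + e * (2 * p ord0 j + 2 * t).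
  apply: (@derive2_at_max f f').
  - move=> t; rewrite /f /f' /V.
    have Ut := U1 j p t; apply: is_deriveD; apply: is_deriveZ.
    rewrite (_ : (fun t => _) =
        fun t => \sum_i p ord0 i ^+ 2 + (2 * p ord0 j * t + t ^+ 2)).
      by apply: is_derive_eq; rewrite /GRing.scale/=; ring.
    exact/funext/qE.
  - rewrite /f'; have := U2 j p 0; rewrite scale0r addr0 => U20.
    by apply: is_derive_eq; rewrite /GRing.scale/=; ring.
  - move=> t; rewrite in_itv/= => /andP[t1 t2]; rewrite /f scale0r addr0.
    apply: pmax; rewrite inE => i; rewrite rowD_delta.
    rewrite (le_trans (ler_normD _ _))// lerD// normrM.
    have t1' : `|t| <= 1 by rewrite ler_norml; lra.
    by case: (i == j); rewrite ?normr1 ?normr0 ?mulr1 ?mulr0.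
have : \sum_j (d2 j p + 2 * e) <= 0 by apply: sumr_le0.
rewrite big_split/= lap add0r sumr_const card_ord leNgt.
by rewrite pmulrn_lgt0// mulr_gt0.
Qed.

Lemma harmonic_decay_eq0 (U : Rn -> R) (d1 d2 : 'I_n -> Rn -> R) : (0 < n)%N ->
  continuous U ->
  vanishes_at_infinity U ->
  (forall j x t,
    is_derive t (1 : R) (fun t => U (x + t *: 'e_j)) (d1 j (x + t *: 'e_j))) ->
  (forall j x t,
    is_derive t (1 : R) (fun t => d1 j (x + t *: 'e_j)) (d2 j (x + t *: 'e_j))) ->
  (forall x, \sum_j d2 j x = 0) -> forall x, U x = 0.
Proof.
move=> n0 cU decay U1 U2 lap x; apply/eqP; rewrite eq_le.
rewrite (harmonic_decay_le0 n0 cU decay U1 U2 lap)/= -oppr_le0.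
apply: (@harmonic_decay_le0 (fun x => - U x) (fun j x => - d1 j x)
  (fun j x => - d2 j x)) => //.
- by move=> y; apply: continuousN; exact: cU.
- move=> e /decay[r Ur]; exists r => y /Ur; rewrite normrN; exact.
- by move=> y; rewrite sumrN lap oppr0.
Qed.

End maximum_principle.

(** * Clifford-valued functions all of whose cube fluxes vanish *)

Section clifford_liouville.
Context {R : realType} {n : nat}.
Local Notation Rn := 'rV[R]_n.
Local Notation cl := (clifford R n).

Definition gensign (j : 'I_n) (C : {set 'I_n}) : R :=
  clsign [set j]%SET (symdiff [set j]%SET C).

Lemma clgen_mulE (j : 'I_n) (a : cl) (C : {set 'I_n}) :
  (clgen j * a) C = gensign j C * a (symdiff [set j]%SET C).
Proof.
rewrite ffunE (bigD1 [set j]%SET)//= big1 ?addr0 => [|A Aj].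
  by rewrite ffunE eqxx mulr1.
by rewrite ffunE (negbTE Aj) mulr0 mul0r.
Qed.

Lemma facediff_sum (h : R) (j : 'I_n) (I : finType) (c : I -> R)
    (f : I -> Rn -> R) :
  0 < h -> (forall i, ucont (f i)) ->
  facediff h j (fun x => \sum_i c i * f i x) =
  fun x => \sum_i c i * facediff h j (f i) x.
Proof.
move=> h0 uf; rewrite /index_enum; elim: (Finite.enum I) => [|i r IHr].
  have u0 := @ucont_cst R n 0; rewrite (_ : (fun x => _) =
      fun x => 0 * (fun=> 0 : R) x + 0 * (fun=> 0 : R) x).
    by rewrite facediffD//; apply/funext => x; rewrite big_nil !mul0r addr0.
  by apply/funext => x; rewrite big_nil !mul0r addr0.
have us : ucont (fun x => \sum_(i <- r) c i * f i x).
  elim: {IHr} r => [|k r IHr].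
    by under eq_fun do rewrite big_nil; exact: ucont_cst.
  have := ucontD (c k) 1 (uf k) IHr; congr ucont.
  by apply/funext => x; rewrite big_cons mul1r.
rewrite (_ : (fun x => _) =
    fun x => c i * f i x + 1 * \sum_(i <- r) c i * f i x); last first.
  by apply/funext => x; rewrite big_cons mul1r.
by rewrite facediffD// IHr; apply/funext => x; rewrite big_cons mul1r.
Qed.

Lemma cubeavg_decay (h : R) (f : Rn -> R) : 0 < h -> ucont f ->
  vanishes_at_infinity f ->
  vanishes_at_infinity (cubeavg h f).
Proof.
move=> h0 uf df e /df[r fr]; exists (r + h) => x [i xi].
rewrite -[X in `|X|]subr0; apply: cubeavg_bound => // y xy.
rewrite subr0; apply: fr; exists i; have := xy i.
rewrite ltr_normr; move: xi; rewrite ltr_normr => /orP[xi|xi] /andP[y1 y2].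
  by apply/orP; left; lra.
by apply/orP; right; lra.
Qed.

Variable w : Rn -> cl.
Hypothesis n_gt0 : (0 < n)%N.
Hypothesis uw : forall A, ucont (fun x => w x A).
Hypothesis dw : forall A, vanishes_at_infinity (fun x => w x A).
Hypothesis flux0 : forall (h : R) C a, 0 < h ->
  \sum_j gensign j C * facediff h j (fun x => w x (symdiff [set j]%SET C)) a = 0.

Let u A x := w x A.

(* For fixed h the operators X_j = facediff h j are linear and commute, so that
   (\sum_j e_j X_j)^2 = - \sum_j X_j^2. *)
Let facediff2_sum0 (h : R) A a : 0 < h ->
  \sum_j facediff h j (facediff h j (u A)) a = 0.
Proof.
move=> h0.
pose m j k : cl := [ffun B => facediff h j (facediff h k (u B)) a].
have mC j k : m j k = m k j.
  by apply/ffunP => B; rewrite !ffunE facediffC//; exact: uw.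
have m0 j : \sum_k clgen k * m j k = 0.
  apply/ffunP => C; rewrite sum_ffunE [RHS]ffunE.
  under eq_bigr do rewrite clgen_mulE ffunE.
  have := @facediff_sum h j _ (fun k => gensign k C)
    (fun k => facediff h k (u (symdiff [set k]%SET C))) h0.
  move=> /(_ (fun k => facediff_ucont k h0 (uw _)))/(congr1 (@^~ a)) <-.
  rewrite (_ : (fun x => _) = fun=> 0); last by apply/funext => x; exact: flux0.
  have u0 := @ucont_cst R n 0; rewrite (_ : (fun=> 0) =
      fun x => 0 * (fun=> 0 : R) x + 0 * (fun=> 0 : R) x).
    by rewrite facediffD// !mul0r addr0.
  by apply/funext => x; rewrite !mul0r addr0.
have mm0 : \sum_j \sum_k clgen j * clgen k * m j k = 0.
  rewrite big1// => j _; under eq_bigr do rewrite -mulrA.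
  by rewrite -mulr_sumr m0 mulr0.
(* As m is symmetric, exchanging j and k gives the same double sum; only the diagonal survives the
   anticommutation relations. *)
have : \sum_j \sum_k (clgen j * clgen k + clgen k * clgen j) * m j k = 0.
  under eq_bigr => j _ do (under eq_bigr do rewrite mulrDl; rewrite big_split/=).
  rewrite big_split/= mm0 add0r exchange_big/= -[RHS]mm0.
  by apply: eq_bigr => j _; apply: eq_bigr => k _; rewrite mC.
have -> : \sum_j \sum_k (clgen j * clgen k + clgen k * clgen j) * m j k =
    - 2 *: \sum_j m j j.
  rewrite scaler_sumr; apply: eq_bigr => j _.
  rewrite (bigD1 j)//= big1 ?addr0 => [|k kj].
    by rewrite clgen_anticomm eqxx mulr1 -scalerAl mul1r.
  by rewrite clgen_anticomm eq_sym (negbTE kj) mulr0 oppr0 scale0r mul0r.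
move=> /eqP; rewrite scaler_eq0 oppr_eq0 pnatr_eq0/= => /eqP/ffunP/(_ A).
rewrite sum_ffunE [RHS]ffunE => mjj; rewrite -[RHS]mjj.
by apply: eq_bigr => j _; rewrite ffunE.
Qed.

Lemma dirac_flux_eq0 x : w x = 0.
Proof.
apply/ffunP => A; rewrite [RHS]ffunE.
have U0 (h : R) : 0 < h -> forall x, cubeavg h (cubeavg h (u A)) x = 0.
  move=> h0; have uc := cubeavg_ucont h0 (uw A).
  apply: (@harmonic_decay_eq0 _ _ _
    (fun j x => h^-1 * facediff h j (cubeavg h (u A)) x)
    (fun j x => h^-1 * (h^-1 * facediff h j (facediff h j (u A)) x))) => //.
  - exact/ucont_continuous/cubeavg_ucont.
  - apply: cubeavg_decay => //; apply: cubeavg_decay => //; [exact: uw|exact: dw].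
  - by move=> j y t; exact: cubeavg_derive.
  - by move=> j y t; apply: cubeavg_derive2 => //; exact: uw.
  - by move=> y; rewrite -!mulr_sumr facediff2_sum0// !mulr0.
apply/eqP; rewrite -normr_le0; apply/ler_addgt0Pr => e e0; rewrite add0r.
(* The double average samples x + [0, 2h]^n, whose side d / 2 is below d. *)
have [d d0 ud] := uw A e0; have h0 : 0 < d / 4 by rewrite divr_gt0.
rewrite -normrN -sub0r -(U0 _ h0 x).
apply: cubeavg_bound => // [|y xy]; first exact/cubeavg_ucont/uw.
apply: cubeavg_bound => // [|z yz]; first exact: uw.
apply: ud => i; have := xy i; have := yz i; rewrite ltr_norml; lra.
Qed.

End clifford_liouville.

(** * Coverings of small Hausdorff measure *)

Section hausdorff_covers.
Context {R : realType} {n : nat}.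
Local Notation Rn := 'rV[R]_n.
Implicit Types (S E : set Rn).

Lemma coord_le_enorm (x : Rn) i : `|x ord0 i| <= enorm x.
Proof.
rewrite -sqrtr_sqr /enorm /l2norm ler_wsqrtr// (bigD1 i)//= lerDl.
by apply: sumr_ge0 => j _; exact: sqr_ge0.
Qed.

Lemma enorm_ge0 (x : Rn) : 0 <= enorm x.
Proof. exact: sqrtr_ge0. Qed.

Lemma enorm_le_diameter (d : R) E x y : diam_le d E -> E x -> E y ->
  enorm (x - y) <= diameter E <= d.
Proof.
move=> Ed Ex Ey; apply/andP; split.
  apply: ub_le_sup; last by exists (x, y).
  by exists d => _ [[p q] [/= Ep Eq] <-]; exact: Ed.
apply: ge_sup; first by exists (enorm (x - y)), (x, y).
by move=> _ [[p q] [/= Ep Eq] <-]; exact: Ed.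
Qed.

Lemma diameter_ge0 E : 0 <= diameter E.
Proof.
rewrite /diameter; set A := (X in sup X).
have [supA|/sup_out ->//] := pselect (has_sup A).
have [_ [p [Ep Eq] _]] := supA.1.
apply: le_trans (sup_upper_bound supA _); last by exists p.
exact: enorm_ge0.
Qed.

Lemma diameter_le (d : R) E : 0 <= d -> diam_le d E -> diameter E <= d.
Proof.
move=> d0 Ed; rewrite /diameter; set A := (X in sup X).
have [supA|/sup_out ->//] := pselect (has_sup A).
by apply: ge_sup supA.1 _ => _ [[p q] [/= Ep Eq] <-]; exact: Ed.
Qed.

(** Distinct indices below m contribute at most the full geometric sum 1 - 2^-m. These are the
    weights that share out the error among the sets of a cover. *)
Lemma sum_half_expn_le1 (s : seq nat) : uniq s ->
  \sum_(k <- s) (2^-1 : R) ^+ k.+1 <= 1.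
Proof.
suff H m s' : uniq s' -> all (ltn^~ m) s' ->
    \sum_(k <- s') (2^-1 : R) ^+ k.+1 <= 1 - 2^-1 ^+ m.
  move=> us; apply: le_trans (H (\max_(k <- s) k).+1 s us _) _.
    by apply/allP => k ks; rewrite /= ltnS; exact: leq_bigmax_seq.
  by rewrite lerBlDr lerDl exprn_ge0.
elim: m s' => [|m IHm] s' us' s'm.
  case: s' us' s'm => [_ _|//].
  by rewrite big_nil subrr.
have rem_lt s1 : uniq s1 -> all (ltn^~ m.+1) s1 -> m \notin s1 ->
    all (ltn^~ m) s1.
  move=> us1 /allP s1m ms1; apply/allP => k ks1 /=.
  rewrite ltn_neqAle -ltnS; have /= -> := s1m _ ks1; rewrite andbT.
  by apply: contraNneq ms1 => <-.
have [ms|ms] := boolP (m \in s'); last first.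
  apply: le_trans (IHm _ us' (rem_lt _ us' s'm ms)) _.
  have : 0 <= (2^-1 : R) ^+ m by rewrite exprn_ge0.
  by rewrite exprS; move: (_ ^+ m) => p; lra.
rewrite (perm_big _ (perm_to_rem ms)) big_cons/=.
have := IHm (rem m s') (rem_uniq m us'); rewrite (_ : all _ _ = true).
  by move=> /(_ isT); rewrite exprS; move: (bigop _ _ _) (_ ^+ m) => b p; lra.
apply: rem_lt; first exact: rem_uniq.
  by apply/allP => k /mem_rem; move: k; exact/allP.
by rewrite mem_rem_uniq// inE eqxx.
Qed.

(** A set of diameter D, possibly 0, only fits in an open ball of larger radius. Take r^kappa =
    D^kappa + e with e at most eta and half of the gap to d^kappa; D <= 1 gives D^kappa <= D^s. *)
Lemma enlarge_radius (D d s kappa eta : R) : 0 <= D -> D < d -> D <= 1 ->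
  s <= kappa -> 0 < kappa -> 0 < eta ->
  exists r, [/\ D < r, r < d & r `^ kappa <= D `^ s + eta].
Proof.
move=> D0 Dd D1 sk k0 eta0; have d0 := le_lt_trans D0 Dd.
have Dk : D `^ kappa < d `^ kappa.
  by apply: gt0_ltr_powR; rewrite ?nnegrE// ltW.
have Ds : D `^ kappa <= D `^ s.
  move: D0; rewrite le_eqVlt => /predU1P[<-|D0].
    by rewrite powR0 ?powR_ge0// gt_eqF.
  by apply: ger_powR; rewrite ?D0.
pose e := Num.min eta ((d `^ kappa - D `^ kappa) / 2).
have e0 : 0 < e by rewrite lt_min eta0/= divr_gt0// subr_gt0.
have e1 : e <= eta by rewrite ge_min lexx.
have e2 : e <= (d `^ kappa - D `^ kappa) / 2 by rewrite ge_min lexx orbT.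
have p0 := powR_ge0 D kappa.
have powK x : 0 <= x -> (x `^ kappa) `^ kappa^-1 = x.
  by move=> x0; rewrite -powRrM mulfV ?gt_eqF// powRr1.
exists ((D `^ kappa + e) `^ kappa^-1); split.
- rewrite -[X in X < _](powK _ D0); apply: gt0_ltr_powR.
  + by rewrite invr_gt0.
  + by rewrite nnegrE.
  + by rewrite nnegrE addr_ge0// ltW.
  + by rewrite ltrDl.
- rewrite -[X in _ < X](powK _ (ltW d0)); apply: gt0_ltr_powR.
  + by rewrite invr_gt0.
  + by rewrite nnegrE addr_ge0// ltW.
  + by rewrite nnegrE powR_ge0.
  + lra.
- rewrite -powRrM mulVf ?gt_eqF// powRr1 ?addr_ge0 ?(ltW e0)//; lra.
Qed.

Lemma hausdorff_finite_cover S (kappa : R) : (hausdorff_dim S < kappa%:E)%E ->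
  compact S -> 0 < kappa ->
  forall e d : R, 0 < e -> 0 < d -> exists N (c : 'I_N -> Rn) (r : 'I_N -> R),
  [/\ forall k, 0 < r k < d,
      forall x, S x -> exists k, forall i, `|x ord0 i - c k ord0 i| < r k &
      \sum_k r k `^ kappa <= e].
Proof.
move=> dimS cS k0 e d e0 d0.
have [_ [s [s0 Hs0] <-]] := ereal_inf_lt dimS; rewrite lte_fin => sk.
(* The bound 1 permits raising the exponent from s to kappa, and d / 2 leaves room to enlarge the
   radii below d. *)
pose delta := Num.min 1 (d / 2).
have delta0 : 0 < delta by rewrite lt_min ltr01 divr_gt0.
have delta1 : delta <= 1 by rewrite ge_min lexx.
have deltad : delta < d by rewrite gt_min; apply/orP; right; lra.
have H0 : (hausdorff_premeasure s delta S <= 0)%E.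
  by rewrite -Hs0; apply: ereal_sup_ubound; exists delta.
have e20 : 0 < e / 2 by rewrite divr_gt0.
have : (hausdorff_premeasure s delta S < (e / 2)%:E)%E.
  by apply: le_lt_trans H0 _; rewrite lte_fin.
move=> /ereal_inf_lt[_ [I [F [FP SF ->]]] Fe].
have eta0 k : 0 < e / 2 * 2^-1 ^+ k.+1 by rewrite mulr_gt0// exprn_gt0.
have /choice[r rP] k : exists r, I k ->
    [/\ diameter (F k) < r, r < d &
      r `^ kappa <= diameter (F k) `^ s + e / 2 * 2^-1 ^+ k.+1].
  have [Ik|nIk] := pselect (I k); last by exists 0.
  have Fk := diameter_le (ltW delta0) (FP _ Ik).
  have [r rP] := enlarge_radius (diameter_ge0 (F k)) (le_lt_trans Fk deltad)
    (le_trans Fk delta1) (ltW sk) k0 (eta0 k).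
  by exists r.
(* Any point of F k can be the centre, since r k exceeds the diameter; for empty F k the centre is
   irrelevant. *)
pose c k : Rn := xget 0 (F k).
have r0 k : I k -> 0 < r k.
  by move=> /rP[+ _ _]; apply: le_lt_trans; exact: diameter_ge0.
move: cS; rewrite compact_cover => /(_ _ I (fun k => ball (c k) (r k))).
case=> [k Ik||D DI SD].
- by apply: ball_open; exact: r0.
- move=> x /SF[k Ik Fkx]; exists k => //.
  have Fkc : F k (c k) by rewrite /c; case: xgetP => [//|/(_ x)].
  have /andP[xc _] := enorm_le_diameter (FP _ Ik) Fkc Fkx.
  split=> [|i j]; first exact: r0.
  have [cr _ _] := rP _ Ik; apply: le_lt_trans cr; apply: le_trans xc.
  by rewrite ord1; have := coord_le_enorm (c k - x) j; rewrite !mxE.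
pose t : seq nat := finmap.enum_fset D.
have ut : uniq t by exact: finmap.fset_uniq.
have tI k : k \in t -> I k by move=> kt; have := DI k kt; rewrite in_setE.
exists (size t), (fun k => c (nth 0%N t k)), (fun k => r (nth 0%N t k)); split.
- move=> k; have Ik := tI _ (mem_nth 0%N (ltn_ord k)).
  by rewrite r0//=; have [] := rP _ Ik.
- move=> x /SD[k /= kD [_ xk]].
  have kt : (index k t < size t)%N by rewrite index_mem.
  exists (Ordinal kt) => i; rewrite /= nth_index// distrC; exact: xk.
rewrite -(big_mkord xpredT (fun k => r (nth 0%N t k) `^ kappa)).
rewrite -(big_nth 0%N xpredT (fun k => r k `^ kappa)).
apply: (@le_trans _ _ (\sum_(k <- t)
    (diameter (F k) `^ s + e / 2 * 2^-1 ^+ k.+1))).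
  rewrite big_seq [leRHS]big_seq; apply: ler_sum => k kt.
  by have [] := rP _ (tI _ kt).
rewrite big_split/= -mulr_sumr [leRHS](splitr e).
apply: lerD; last by rewrite ler_piMr ?(ltW e20)//; exact: sum_half_expn_le1.
rewrite -lee_fin; apply: le_trans (ltW Fe).
rewrite -sumEFin fsbig_seq//; apply: ereal_sup_ubound.
by exists [set` t] => //; split; [exact: finite_seq|move=> k /= /tI].
Qed.

End hausdorff_covers.

(** * Removability for Hoelder continuous monogenic functions *)

Section glueing.
Context {R : realType} {n : nat}.
Local Notation Rn := 'rV[R]_n.
Local Notation cl := (clifford R n).

(** Compactness handles x in the cube of half-side r + 1. For x outside, d < 1 keeps y beyond r, and
    both values are at most e / 2. *)
Lemma continuous_decay_ucont (f : Rn -> R) : continuous f ->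
  vanishes_at_infinity f -> ucont f.
Proof.
move=> cf df e e0; have e20 : 0 < e / 2 by rewrite divr_gt0.
have [r fr] := df _ e20.
have cQ := @compact_cube R n (r + 1).
have H : \forall d \near 0^'+, [set x : Rn | forall i, `|x ord0 i| <= r + 1] `<=`
    (fun x : Rn => forall y : Rn, (forall i, `|x ord0 i - y ord0 i| < d) ->
      `|f x - f y| <= e).
  move/compact_near_coveringP : cQ; apply => x _.
  have [d d0 fd] : exists2 d, 0 < d &
      forall y : Rn, (forall i, `|x ord0 i - y ord0 i| < d) ->
        `|f x - f y| <= e / 2.
    apply: coords_near.
    exact: ((iffLR (@cvgrPdist_le _ _ _ _ (nbhs_filter x) f (f x))) (cf x) _ e20).
  have d20 : 0 < d / 2 by rewrite divr_gt0.
  exists ([set y : Rn | forall i, `|x ord0 i - y ord0 i| < d / 2],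
    [set t : R | t < d / 2]).
    by split; [exact: near_coords|exact: nbhs_right_lt].
  move=> [y t] /= [xy td] z yz.
  have H1 : `|f x - f y| <= e / 2.
    by apply: fd => i; have := xy i; lra.
  have H2 : `|f x - f z| <= e / 2.
    apply: fd => i; have := xy i; have := yz i; rewrite !ltr_norml; lra.
  by move: H1 H2; rewrite !ler_norml; lra.
have [d [d0 [d1 dP]]] : exists d : R, 0 < d /\ d < 1 /\
    [set x : Rn | forall i, `|x ord0 i| <= r + 1] `<=`
    (fun x : Rn => forall y : Rn, (forall i, `|x ord0 i - y ord0 i| < d) ->
      `|f x - f y| <= e).
  have : \forall d \near 0^'+, 0 < d /\ d < 1 /\
    [set x : Rn | forall i, `|x ord0 i| <= r + 1] `<=`
    (fun x : Rn => forall y : Rn, (forall i, `|x ord0 i - y ord0 i| < d) ->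
      `|f x - f y| <= e).
    near=> d; split; [by []|split; last by near: d].
    by near: d; exact: nbhs_right_lt.
  by move=> /filter_ex[d dP]; exists d.
exists d => // x y xy.
have [xQ|] := pselect (forall i, `|x ord0 i| <= r + 1); first exact: dP.
move=> /existsNP[i /negP]; rewrite -ltNge => xi.
have fx : `|f x| <= e / 2 by apply: fr; exists i; lra.
have fy : `|f y| <= e / 2.
  apply: fr; exists i; have := xy i; move: xi.
  by have := ler_normD (x ord0 i - y ord0 i) (y ord0 i);
    rewrite subrK; lra.
by move: fx fy; rewrite !ler_norml; lra.
Unshelve. all: end_near. Qed.

Lemma continuous_decay_bounded (f : Rn -> R) : continuous f ->
  vanishes_at_infinity f ->
  exists2 B : R, 0 <= B & forall x, `|f x| <= B.
Proof.
move=> cf /(_ 1 ltr01)[r fr].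
pose Q := [set x : Rn | forall i, `|x ord0 i| <= `|r|].
have Q0 : Q !=set0 by exists 0 => i; rewrite mxE normr0.
have cQ : compact Q by exact: compact_cube.
have [p _ fp] := EVT_max_rV Q0 cQ (continuous_subspaceT cf).
have [q _ fq] := EVT_min_rV Q0 cQ (continuous_subspaceT cf).
exists (1 + `|f p| + `|f q|) => [|x]; first by rewrite !addr_ge0.
have [xQ|] := pselect (Q x).
  have := fp x; have := fq x; rewrite inE => /(_ xQ) + /(_ xQ).
  have := ler_norm (f p); have := ler_norm (- f q); rewrite normrN.
  have := normr_ge0 (f p); have := normr_ge0 (f q).
  by rewrite ler_norml; lra.
move=> /existsNP[i /negP]; rewrite -ltNge => xi.
have : `|f x| <= 1 by apply: fr; exists i; apply: le_lt_trans xi; exact: ler_norm.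
by have := normr_ge0 (f p); have := normr_ge0 (f q); lra.
Qed.

(** The supremum of the points of A in [a, b] lies in A, and it is b or a limit of later points,
    which all lie in B. *)
Lemma closed_cover_meet (A B : set R) (a b : R) : a <= b -> closed A -> closed B ->
  (forall t, A t \/ B t) -> A a -> B b -> exists s, [/\ a <= s <= b, A s & B s].
Proof.
move=> ab cA cB AB Aa Bb; pose T := [set t | a <= t <= b /\ A t].
have Ta : T a by split; rewrite ?lexx.
have Tub : has_ubound T by exists b => t [/andP[]].
have as_ : a <= sup T by apply: ub_le_sup.
have sb : sup T <= b by apply: ge_sup; [exists a|move=> t [/andP[]]].
exists (sup T); split; first by rewrite as_.
  apply: cA; apply: (@closureS _ T); first by move=> t [].
  by apply: closure_sup => //; exists a.
apply: cB; have [->|sNb] := eqVneq (sup T) b; first exact: subset_closure.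
have {sNb} sb' : sup T < b by rewrite lt_neqAle sNb.
move=> U /nbhs_ballP[e /= e0 eU].
pose t := Num.min b (sup T + e / 2).
have [st tb te] : [/\ sup T < t, t <= b & t <= sup T + e / 2].
  by rewrite /t lt_min sb' ltrDl divr_gt0// !ge_min !lexx orbT.
exists t; split.
  have [At|//] := AB t; exfalso.
  have : t <= sup T by apply: ub_le_sup => //; split=> //; rewrite tb; lra.
  by rewrite leNgt st.
by apply: eU; rewrite /ball/= ltr_norml; lra.
Qed.

Lemma line_continuous (x : Rn) (j : 'I_n) : continuous (fun t : R => x + t *: 'e_j).
Proof.
move=> t U /coords_near[d d0 dU]; apply/nbhs_ballP; exists d => // s ts.
apply: dU => i; rewrite !rowD_delta opprD addrACA subrr add0r -mulrBl normrM.
by apply: le_lt_trans ts; rewrite ler_piMr// ger0_norm ?ler0n// lern1 leq_b1.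
Qed.

Lemma enorm_line (x : Rn) (j : 'I_n) (s t : R) :
  enorm (x + s *: 'e_j - (x + t *: 'e_j)) = `|s - t|.
Proof.
rewrite opprD addrACA subrr add0r -scalerBl /enorm /l2norm (bigD1 j)//= big1.
  by rewrite !mxE !eqxx mulr1 addr0 sqrtr_sqr.
by move=> i /negbTE ij; rewrite !mxE ij andbF mulr0 expr0n.
Qed.

(** A segment joining the two sets meets their intersection, and the two bounds add up through that
    point. Segments along axes suffice, as fluxes only see increments between opposite faces. *)
Lemma hoelder_glue (A B : set Rn) (f : Rn -> cl) (M mu : R) : 0 <= mu -> 0 <= M ->
  closed A -> closed B -> (forall x, A x \/ B x) ->
  (forall x y, A x -> A y -> `|f x - f y| <= M * enorm (x - y) `^ mu) ->
  (forall x y, B x -> B y -> `|f x - f y| <= M * enorm (x - y) `^ mu) ->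
  forall x (j : 'I_n) (h : R), 0 < h ->
  `|f (x + h *: 'e_j) - f x| <= (M + M) * h `^ mu.
Proof.
move=> mu0 M0; move: A B.
have main (A B : set Rn) : closed A -> closed B -> (forall x, A x \/ B x) ->
    (forall x y, A x -> A y -> `|f x - f y| <= M * enorm (x - y) `^ mu) ->
    (forall x y, B x -> B y -> `|f x - f y| <= M * enorm (x - y) `^ mu) ->
    forall x (j : 'I_n) (h : R), 0 < h -> A x ->
    `|f (x + h *: 'e_j) - f x| <= (M + M) * h `^ mu.
  move=> cA cB AB fA fB x j h h0 Ax.
  have lA : closed ((fun t : R => x + t *: 'e_j) @^-1` A).
    by apply: preimage_closed => // t _; exact: line_continuous.
  have lB : closed ((fun t : R => x + t *: 'e_j) @^-1` B).
    by apply: preimage_closed => // t _; exact: line_continuous.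
  have x0 : x + 0 *: 'e_j = x by rewrite scale0r addr0.
  have enorm_x t : enorm (x + t *: 'e_j - x) = `|t|.
    by have := enorm_line x j t 0; rewrite x0 subr0.
  have p0 := powR_ge0 h mu.
  have [Ah|Bh] := AB (x + h *: 'e_j).
    apply: le_trans (fA _ _ Ah Ax) _.
    rewrite enorm_x gtr0_norm// ler_wpM2r//; lra.
  have [|t [/andP[t0 th] At Bt]] :=
      closed_cover_meet (ltW h0) lA lB (fun t => AB _) _ Bh.
    by rewrite /preimage/= x0.
  have le1 := fB _ _ Bh Bt; have le2 := fA _ _ At Ax.
  move: le1 le2; rewrite enorm_line enorm_x !ger0_norm ?subr_ge0// => le1 le2.
  rewrite -(subrKA (f (x + t *: 'e_j))) mulrDl.
  apply: le_trans (ler_normD _ _) (lerD (le_trans le1 _) (le_trans le2 _)).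
    by rewrite ler_wpM2l//; apply: ge0_ler_powR; rewrite ?nnegrE; lra.
  by rewrite ler_wpM2l//; apply: ge0_ler_powR; rewrite ?nnegrE; lra.
move=> A B cA cB AB fA fB x j h h0; have [Ax|Bx] := AB x.
  exact: (main A B).
by apply: (main B A) => // y; have [] := AB y; [right|left].
Qed.

End glueing.

Section clifford_coordinates.
Context {R : realType} {n : nat}.
Local Notation Rn := 'rV[R]_n.
Local Notation cl := (clifford R n).
Implicit Types A : {set 'I_n}.

Lemma clcoord_le_norm (a : cl) A : `|a A| <= `|a|.
Proof.
rewrite clnormE -sqrtr_sqr /l2norm ler_wsqrtr// (bigD1 A)//= lerDl.
by apply: sumr_ge0 => B _; exact: sqr_ge0.
Qed.

Lemma clcoord_cvg {T : Type} (F : set_system T) {FF : Filter F} (f : T -> cl)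
    (l : cl) A :
  f @ F --> l -> (fun x => f x A) @ F --> l A.
Proof.
move=> fl; apply/cvgrPdist_le => e e0.
have := iffLR (@cvgrPdist_le _ _ _ _ FF f l) fl e e0; apply: filterS => x.
by apply: le_trans; have := clcoord_le_norm (l - f x) A; rewrite !ffunE.
Qed.

Lemma is_derive_coord (u : Rn -> cl) (j : 'I_n) (x : Rn) (t : R) A :
  derivable u (x + t *: 'e_j) 'e_j ->
  is_derive t (1 : R) (fun t => u (x + t *: 'e_j) A)
    (partial j u (x + t *: 'e_j) A).
Proof.
move=> du; have {}du :
    h^-1 *: (u (h *: 'e_j + (x + t *: 'e_j)) - u (x + t *: 'e_j))
    @[h --> (0 : R)^'] --> partial j u (x + t *: 'e_j) by exact: du.
have {}du := @clcoord_cvg _ _ _ _ _ A du.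
have E : (fun h : R =>
      (h^-1 *: (u (h *: 'e_j + (x + t *: 'e_j)) - u (x + t *: 'e_j))) A) =
    (fun h : R =>
      h^-1 *: (u (x + (h *: 1 + t) *: 'e_j) A - u (x + t *: 'e_j) A)).
  apply/funext => h; rewrite !ffunE; congr (_ *: (u _ A - _)).
  by rewrite -[h *: 1]/(h * 1) mulr1 scalerDl addrCA.
rewrite E in du.
apply: DeriveDef.
  by apply/cvg_ex; exists (partial j u (x + t *: 'e_j) A); exact: du.
by rewrite /derive; apply: cvg_lim; [exact: Rhausdorff|exact: du].
Qed.

End clifford_coordinates.

Section removability.
Context {R : realType} {n : nat}.
Local Notation Rn := 'rV[R]_n.
Local Notation cl := (clifford R n).

Lemma gensign_norm (j : 'I_n) C : `|gensign j C : R| = 1.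
Proof.
have : (gensign j C : R) ^+ 2 = 1 by rewrite expr2 clsign_sq.
by move=> /eqP; rewrite sqrf_eq1 => /orP[]/eqP->; rewrite ?normrN normr1.
Qed.

Lemma removable_monogenic_eq0 (S : set Rn) (w : Rn -> cl) (M mu : R)
    (dw : 'I_n -> Rn -> cl) : (0 < n)%N -> compact S ->
  (forall A, continuous (fun x => w x A)) ->
  (forall A, vanishes_at_infinity (fun x => w x A)) ->
  0 <= M -> 0 <= mu -> 0 < n.-1%:R + mu ->
  (forall A x (j : 'I_n) (h : R), 0 < h ->
    `|w (x + h *: 'e_j) A - w x A| <= M * h `^ mu) ->
  (hausdorff_dim S < (n.-1%:R + mu)%:E)%E ->
  (forall A j x t, ~ S (x + t *: 'e_j) ->
    is_derive t (1 : R) (fun t => w (x + t *: 'e_j) A)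
      (dw j (x + t *: 'e_j) A)) ->
  (forall A j x, ~ S x -> {for x, continuous (fun y => dw j y A)}) ->
  (forall x, ~ S x -> \sum_j clgen j * dw j x = 0) ->
  forall x, w x = 0.
Proof.
move=> n0 cS cw decw M0 mu0 k0 hw dimS dwP cdw dirac0.
have uw A : ucont (fun x => w x A).
  by apply: continuous_decay_ucont; [exact: cw|exact: decw].
apply: dirac_flux_eq0 => // h C a h0.
(* With this field the divergence is the component at C of the Dirac operator. *)
pose v (j : 'I_n) (x : Rn) := gensign j C * w x (symdiff [set j]%SET C).
pose dv (j : 'I_n) (x : Rn) := gensign j C * dw j x (symdiff [set j]%SET C).
have uv j : ucont (v j).
  have := ucontD (gensign j C) 0 (uw (symdiff [set j]%SET C))
    (uw (symdiff [set j]%SET C)).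
  by congr ucont; apply/funext => x; rewrite mul0r addr0.
have hv j (x : Rn) (t : R) : 0 < t ->
    `|v j (x + t *: 'e_j) - v j x| <= M * t `^ mu.
  by move=> t0; rewrite -mulrBr normrM gensign_norm mul1r hw.
have cSc : open (~` S).
  by apply: closed_openC; apply: compact_closed => //; exact: norm_hausdorff.
have openS (x : Rn) : ~ S x -> exists2 d : R, 0 < d &
    forall y : Rn, (forall i, `|y ord0 i - x ord0 i| < d) -> ~ S y.
  move=> Sx; have [d d0 dS] := coords_near (open_nbhs_nbhs (conj cSc Sx)).
  by exists d => // y xy; apply: dS => i; rewrite distrC.
have dvP j (x : Rn) (t : R) : ~ S (x + t *: 'e_j) ->
    is_derive t (1 : R) (fun t => v j (x + t *: 'e_j)) (dv j (x + t *: 'e_j)).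
  by move=> /dwP dwt; have := dwt (symdiff [set j]%SET C) => ?; apply: is_deriveZ.
have dvC (x : Rn) : ~ S x -> forall e : R, 0 < e -> exists2 d : R, 0 < d &
    forall (y : Rn) j, (forall i, `|y ord0 i - x ord0 i| < d) ->
      `|dv j y - dv j x| <= e.
  move=> Sx e e0; have [|d d0 dP] := @coords_near R n x
      [set y : Rn | forall j, `|dv j y - dv j x| <= e].
    apply: (@filter_forall _ _ (fun j (y : Rn) => `|dv j y - dv j x| <= e) _
      (nbhs_filter x)) => j.
    have := iffLR (@cvgrPdist_le _ _ _ _ (nbhs_filter x) _ _)
      (cdw (symdiff [set j]%SET C) j x Sx) e e0.
    apply: filterS => y; rewrite distrC; apply: le_trans.
    by rewrite -mulrBr normrM gensign_norm mul1r.
  by exists d => // y j xy; apply: dP => i; rewrite distrC.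
have div0 (x : Rn) : ~ S x -> \sum_j dv j x = 0.
  move=> /dirac0/ffunP/(_ C); rewrite sum_ffunE [RHS]ffunE => dvx.
  by rewrite -[RHS]dvx; apply: eq_bigr => j _; rewrite clgen_mulE.
have cov := hausdorff_finite_cover dimS cS k0.
have := flux_eq0 uv mu0 M0 n0 hv openS dvP dvC div0 cov a h0.
move=> /eqP; rewrite mulf_eq0 expf_eq0 (gt_eqF h0) andbF /= => /eqP fl.
rewrite -[RHS]fl; apply: eq_bigr => j _.
by rewrite facediffZ.
Qed.

End removability.

(** * Uniqueness for the jump problem *)

Lemma holder_onB (R : realType) (n : nat) (mu : R) (D : set 'rV[R]_n)
    (u v : 'rV[R]_n -> clifford R n) : holder_on mu D u -> holder_on mu D v ->
  exists2 M : R, 0 <= M & forall x y, D x -> D y ->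
    `|(u x - v x) - (u y - v y)| <= M * enorm (x - y) `^ mu.
Proof.
move=> [M uM] [N vN]; exists (`|M| + `|N|) => [|x y Dx Dy].
  by rewrite addr_ge0.
have -> : u x - v x - (u y - v y) = (u x - u y) - (v x - v y).
  by rewrite !opprB addrACA [RHS]addrACA (addrC (- v x)).
rewrite mulrDl; apply: le_trans (ler_normB _ _) (lerD _ _).
  apply: le_trans (uM _ _ Dx Dy) _; rewrite ler_wpM2r ?powR_ge0//.
  exact: ler_norm.
apply: le_trans (vN _ _ Dx Dy) _; rewrite ler_wpM2r ?powR_ge0//.
exact: ler_norm.
Qed.

Theorem theorem8 (R : realType) (n : nat) (S Om : set 'rV[R]_n) (r nu mu : R)
  (g : 'rV[R]_n -> clifford R n) (c : clifford R n)
  (hn : (2 <= n)%N)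
  (cS : compact S) (hS : topological_hypersurface S)
  (hOm : jordan_domain Om) (hbd : S = boundary Om)
  (hr : S `<=` eball r)
  (hnu : 0 < nu <= 1) (hg : holder_on nu S g)
  (hnum : (1 - marcinkiewicz S Om r / n%:R%:E < nu%:E)%E)
  (hmu1 : (hausdorff_dim S - (n%:R - 1)%:E < mu%:E)%E)
  (hmu2 : (mu%:E < 1 - (n%:R * (1 - nu))%:E / marcinkiewicz S Om r)%E)
  (Phi1 Phi1p Phi1m Phi2 Phi2p Phi2m : 'rV[R]_n -> clifford R n)
  (sol1 : jump_solution S Om g c Phi1 Phi1p Phi1m)
  (sol2 : jump_solution S Om g c Phi2 Phi2p Phi2m)
  (h1p : holder_on mu (closure Om) Phi1p)
  (h1m : holder_on mu (closure (outer_domain S Om)) Phi1m)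
  (h2p : holder_on mu (closure Om) Phi2p)
  (h2m : holder_on mu (closure (outer_domain S Om)) Phi2m) :
  forall x, ~ S x -> Phi1 x = Phi2 x.
Proof.
have [[_ oOm _ _] _] := hOm.
have [[C1 mono1] [cp1 ep1] [cm1 em1] jump1 lim1] := sol1.
have [[C2 mono2] [cp2 ep2] [cm2 em2] jump2 lim2] := sol2.
pose O := outer_domain S Om.
have SE x : S x <-> closure Om x /\ ~ Om x.
  by rewrite hbd /boundary (iffLR (interior_id Om) oOm).
have OE x : O x <-> ~ closure Om x.
  split=> [OSx Clx|nCl]; last by move=> [/subset_closure//|/SE[]].
  by have [Omx|nOm] := pselect (Om x); apply: OSx; [left|right; apply/SE].
pose wp x := Phi1p x - Phi2p x; pose wm x := Phi1m x - Phi2m x.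
pose w x := if `[< closure Om x >] then wp x else wm x.
(* Both solutions have the same jump g, so their difference has none. *)
have wpm x : S x -> wp x = wm x.
  move=> Sx.
  have : Phi1p x - Phi1m x = Phi2p x - Phi2m x by rewrite jump1// jump2.
  move=> /(congr1 (fun z => z + Phi1m x - Phi2p x)); rewrite subrK /wp => ->.
  by rewrite addrC addrA addKr addrC.
have w_p x : closure Om x -> w x = wp x by rewrite /w; case: asboolP.
(* The open set Om is disjoint from O, so the two closures meet only in S, where [wpm] applies. *)
have w_m x : closure O x -> w x = wm x.
  move=> ClO; rewrite /w; case: asboolP => // Clx; apply: wpm.
  apply/SE; split=> // Omx.
  have [y [Oy Omy]] := ClO _ (open_nbhs_nbhs (conj oOm Omx)).
  by move/OE : Oy; apply; exact: subset_closure.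
have w_off x : ~ S x -> w x = Phi1 x - Phi2 x.
  move=> Sx; have [Clx|nCl] := pselect (closure Om x).
    have Omx : Om x by apply: contrapT => nOm; apply: Sx; apply/SE.
    by rewrite w_p// /wp ep1// ep2.
  have Ox : O x by apply/OE.
  by rewrite w_m; [rewrite /wm em1// em2|exact: subset_closure].
suff w0 : forall x, w x = 0.
  by move=> x /w_off; rewrite w0 => /esym/eqP; rewrite subr_eq0 => /eqP.
have cover x : closure Om x \/ closure O x.
  have [|nCl] := pselect (closure Om x); [by left|right].
  exact/subset_closure/OE.
have cw : continuous w.
  have cwp : {within closure Om, continuous w}.
    apply: (@subspace_eq_continuous _ _ _ wp).
      by move=> y; rewrite inE => /w_p.
    by move=> y; apply: cvgB; [exact: cp1|exact: cp2].
  have cwm : {within closure O, continuous w}.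
    apply: (@subspace_eq_continuous _ _ _ wm).
      by move=> y; rewrite inE => /w_m.
    by move=> y; apply: cvgB; [exact: cm1|exact: cm2].
  have := withinU_continuous (@closed_closure _ Om) (@closed_closure _ O) cwp cwm.
  rewrite (_ : closure Om `|` closure O = setT); last first.
    by apply/seteqP; split=> // x _; exact: cover.
  by move=> cwT; apply/continuous_subspace_setT.
have cwA A : continuous (fun x => w x A).
  move=> y; have FF := nbhs_filter y.
  exact: (@clcoord_cvg _ _ _ (nbhs y) FF w (w y) A (cw y)).
have decw A e : 0 < e -> exists r : R, forall x : 'rV[R]_n,
    (exists i, r < `|x ord0 i|) -> `|w x A| <= e.
  move=> e0; have e20 : 0 < e / 2 by rewrite divr_gt0.
  have [r1 H1] := lim1 _ e20; have [r2 H2] := lim2 _ e20.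
  (* Beyond r the point is off S, so w is the difference of the solutions; beyond r1 and r2 each is
     within e / 2 of the common limit c. *)
  exists (Num.max r (Num.max r1 r2)) => y [i]; rewrite !gt_max.
  have yi := coord_le_enorm y i.
  move=> /andP[/lt_le_trans/(_ yi) ry] /andP[/lt_le_trans/(_ yi) r1y].
  move=> /lt_le_trans/(_ yi) r2y.
  rewrite w_off; last by move=> /hr; rewrite /eball/= ltNge (ltW ry).
  apply: le_trans (clcoord_le_norm _ _) _.
  rewrite -(subrKA c); apply: le_trans (ler_normD _ _) _.
  rewrite [leRHS](splitr e) lerD// ltW//; first exact: H1.
  by rewrite distrC; exact: H2.
(* If mu <= 0, then S is null for the (n-1)-dimensional Hausdorff measure and
   the boundedness of w suffices. *)
pose k := Num.max mu 0.
have k0 : 0 <= k by rewrite le_max lexx orbT.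
have [M M0 hw] : exists2 M : R, 0 <= M & forall A x (j : 'I_n) h, 0 < h ->
    `|w (x + h *: delta_mx ord0 j) A - w x A| <= M * h `^ k.
  have [mu0|mu0] := ltP 0 mu.
    have kE : k = mu by rewrite /k max_l// ltW.
    have [Mp Mp0 hp] := holder_onB h1p h2p; have [Mm Mm0 hm] := holder_onB h1m h2m.
    pose M := Num.max Mp Mm.
    have M0 : 0 <= M by rewrite le_max Mp0.
    exists (M + M) => [|A y j h h0]; first by rewrite addr_ge0.
    rewrite kE; apply: (@le_trans _ _ `|w (y + h *: delta_mx ord0 j) - w y|).
      have := clcoord_le_norm (w (y + h *: delta_mx ord0 j) - w y) A.
      by rewrite !ffunE.
    apply: (@hoelder_glue _ _ (closure Om) (closure O)) => //.
    - exact: ltW.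
    - exact: closed_closure.
    - exact: closed_closure.
    - move=> a b Ca Cb; rewrite !w_p//; apply: le_trans (hp _ _ Ca Cb) _.
      by rewrite ler_wpM2r ?powR_ge0// le_max lexx.
    - move=> a b Ca Cb; rewrite !w_m//; apply: le_trans (hm _ _ Ca Cb) _.
      by rewrite ler_wpM2r ?powR_ge0// le_max lexx orbT.
  have kE : k = 0 by rewrite /k max_r.
  have bnd A : exists B : R, 0 <= B /\ forall x, `|w x A| <= B.
    have [B B0 wB] := continuous_decay_bounded (cwA A) (decw A).
    by exists B.
  have [B BP] := choice bnd.
  (* Summing over all components yields one constant valid for each of them. *)
  exists (\sum_A (B A + B A)) => [|A y j h h0].
    by apply: sumr_ge0 => A _; have [B0 _] := BP A; rewrite addr_ge0.
  rewrite kE powRr0 mulr1; have [_ wB] := BP A.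
  apply: le_trans (ler_normB _ _) _; apply: le_trans (lerD (wB _) (wB _)) _.
  rewrite (bigD1 A)//= lerDl sumr_ge0// => A' _.
  by have [B0 _] := BP A'; rewrite addr_ge0.
have n0 : (0 < n)%N by exact: ltn_trans hn.
have nk : n.-1%:R = n%:R - 1 :> R by rewrite -subn1 natrB.
have dimS : (hausdorff_dim S < (n.-1%:R + k)%:E)%E.
  move: hmu1; rewrite lteBlDr// -EFinD => /lt_le_trans; apply.
  by rewrite lee_fin nk addrC lerD2l le_max lexx.
(* Here n >= 2 ensures positivity even when k = 0. *)
have kappa0 : 0 < n.-1%:R + k.
  by rewrite ltr_wpDr// ltr0n -subn1 subn_gt0.
have cSc : open (~` S).
  by apply: closed_openC; apply: compact_closed => //; exact: norm_hausdorff.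
apply: (@removable_monogenic_eq0 _ _ S w M k
  (fun j x => partial j Phi1 x - partial j Phi2 x)) => //.
- move=> A j y t Sy; have [d1 _] := C1 j _ Sy; have [d2 _] := C2 j _ Sy.
  have D1 := is_derive_coord A d1; have D2 := is_derive_coord A d2.
  (* The line may meet S, so w agrees with this difference only for s near t, which suffices for the
     derivative. *)
  pose f s := Phi1 (y + s *: delta_mx ord0 j) A - Phi2 (y + s *: delta_mx ord0 j) A.
  apply: (@near_eq_is_derive _ _ _ f).
    have nS : \forall s \near t, ~ S (y + s *: delta_mx ord0 j).
      exact: (@line_continuous _ _ y j t _ (open_nbhs_nbhs (conj cSc Sy))).
    by move: nS; apply: filterS => s /w_off ->; rewrite /f !ffunE.
  by rewrite !ffunE; exact: is_deriveB.
- move=> A j y Sy; have [_ c1] := C1 j _ Sy; have [_ c2] := C2 j _ Sy.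
  have FF := nbhs_filter y.
  apply: (@clcoord_cvg _ _ _ (nbhs y) FF
    (fun x => partial j Phi1 x - partial j Phi2 x)).
  by apply: cvgB; [exact: c1|exact: c2].
- move=> y Sy; under eq_bigr do rewrite mulrBr.
  by rewrite sumrB -[X in X - _]/(dirac_op Phi1 y) -[X in _ - X]/(dirac_op Phi2 y)
    mono1// mono2// subrr.
Qed.
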